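(* Let $\Gamma=F(A_1,\dots,A_k)$, $k\ge2$, $q=2k-1$, $\sigma^2=(k-1)^{-1}$. Then $$\sup_{\beta\in\mathbb{Z}^k}\left|m^{k/2}\frac{n_{\Gamma,\beta}(m)}{q^m}-\frac{s_{m,\beta}}{(2\pi\sigma^2)^{k/2}}e^{-\langle\beta,\beta\rangle/2\sigma^2m}\right|=o(1)$$ and $$\sup_{\beta\in\mathbb{Z}^k}\left|\frac{m^{k/2}}{2}\left(\frac{N_{\Gamma,\beta}(m)}{q^{m+1}/(q-1)}+\frac{N_{\Gamma,\beta}(m+1)}{q^{m+2}/(q-1)}\right)-\frac{e^{-\langle\beta,\beta\rangle/2\sigma^2m}}{(2\pi\sigma^2)^{k/2}}\right|=o(1)$$ as $m\to\infty$.
   Context: $\Gamma_c$ is the set of cyclically reduced words in $\Gamma$ (reduced words whose first letter times last letter is not the identity), and $\mathrm{wl}(\gamma)$ is word length with respect to $A_1^{\pm1},\dots,A_k^{\pm1}$. $\log_j:\Gamma\to\mathbb{Z}$ is the homomorphism with $\log_j(A_i)=\delta_{ij}$ and $\Phi(\gamma)=(\log_1(\gamma),\dots,\log_k(\gamma))$. For $\beta\in\mathbb{Z}^k$: $n_{\Gamma,\beta}(m)=\#\{\gamma\in\Gamma_c:\mathrm{wl}(\gamma)=m,\ \Phi(\gamma)=\beta\}$, $N_{\Gamma,\beta}(m)=\#\{\gamma\in\Gamma_c:\mathrm{wl}(\gamma)\le m,\ \Phi(\gamma)=\beta\}$, and $s_{m,\beta}=1+(-1)^{m+\beta_1+\dots+\beta_k}$.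 *)

(* Defs.v *)
From HB Require Import structures.
From mathcomp Require Import all_boot all_order all_algebra.
From mathcomp Require Import finmap.
From mathcomp Require Import all_classical all_reals all_analysis.

Set Implicit Arguments.
Unset Strict Implicit.
Unset Printing Implicit Defensive.

Import Order.TTheory GRing.Theory Num.Theory.

Local Open Scope ring_scope.

(* (i, false) stands for A_i and (i, true) for A_i^-1. *)
Definition letter (k : nat) : finType := ('I_k * bool)%type.

Section FreeGroup.
Variable k : nat.
Implicit Types (a b : letter k) (s w : seq (letter k)).

Definition inv_letter a : letter k := (a.1, ~~ a.2).

Definition reduced w := sorted (fun a b => b != inv_letter a) w.

(* Elements of the free group F(A_1, ..., A_k) are reduced words. *)
Record free_group : Type := FreeGroup {
  free_word :> seq (letter k);
  free_wordP : reduced free_word }.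

HB.instance Definition _ := [isSub for free_word].
HB.instance Definition _ := [Choice of free_group by <:].

(* Left multiplication of a reduced word by a letter. *)
Definition push a w : seq (letter k) :=
  if w is b :: w' then if b == inv_letter a then w' else a :: w else [:: a].

Lemma inv_letterK : involutive inv_letter.
Proof. by case=> i e; rewrite /inv_letter /= negbK. Qed.

Lemma reduced_behead a w : reduced (a :: w) -> reduced w.
Proof. exact: path_sorted. Qed.

Lemma push_reduced a w : reduced w -> reduced (push a w).
Proof.
case: w => [//|b w] rbw /=; case: ifPn => [_|nab]; first exact: reduced_behead rbw.
by rewrite /reduced /= nab.
Qed.

Lemma foldr_push_reduced w s : reduced w -> reduced (foldr push w s).
Proof. by move=> rw; elim: s => //= a s; apply: push_reduced. Qed.

Lemma pushK a w : reduced w -> push a (push (inv_letter a) w) = w.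
Proof.
case: w => [|b w] rw /=; first by rewrite eqxx.
rewrite inv_letterK; case: eqP => [Eb|_] /=; last by rewrite eqxx.
move: rw; rewrite Eb; case: w => //= c w; rewrite /reduced /= => /andP[nc _].
by rewrite (negPf nc).
Qed.

Lemma push_foldr a s w : reduced w -> reduced s ->
  foldr push w (push a s) = push a (foldr push w s).
Proof.
move=> rw; case: s => [//|b s] rs /=; case: eqP => [->|//].
by rewrite pushK // foldr_push_reduced.
Qed.

Lemma foldr_pushA s t w : reduced w -> reduced t ->
  foldr push w (foldr push t s) = foldr push (foldr push w t) s.
Proof.
move=> rw rt; elim: s => //= a s IHs.
by rewrite push_foldr ?foldr_push_reduced // IHs.
Qed.

Lemma foldr_push0 s : reduced s -> foldr push [::] s = s.
Proof.
elim: s => //= a s IHs rs; rewrite IHs ?(reduced_behead rs) //.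
by case: s rs {IHs} => //= b s; rewrite /reduced /= => /andP[/negPf->].
Qed.

Definition inv_word s := rev (map inv_letter s).

Lemma inv_word_reduced s : reduced s -> reduced (inv_word s).
Proof.
rewrite /reduced /inv_word rev_sorted sorted_map.
apply: sub_sorted => a b /=; apply: contra => /eqP.
by rewrite inv_letterK => ->.
Qed.

Lemma foldr_push_inv s w : reduced w ->
  foldr push (foldr push w s) (inv_word s) = w.
Proof.
move=> rw; elim: s => //= a s IHs.
rewrite /inv_word /= rev_cons -cats1 foldr_cat /=.
by rewrite -{2}(inv_letterK a) pushK ?IHs // foldr_push_reduced.
Qed.

Definition free_one : free_group := @FreeGroup [::] isT.

Definition free_mul (x y : free_group) : free_group :=
  FreeGroup (foldr_push_reduced x (free_wordP y)).

Definition free_inv (x : free_group) : free_group :=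
  FreeGroup (inv_word_reduced (free_wordP x)).

Lemma free_mulA : associative free_mul.
Proof.
by move=> x y z; apply/val_inj; rewrite /= foldr_pushA ?free_wordP.
Qed.

Lemma free_mul1 : left_id free_one free_mul.
Proof. by move=> x; apply/val_inj. Qed.

Lemma free_mulr1 : right_id free_one free_mul.
Proof. by move=> x; apply/val_inj; rewrite /= foldr_push0 ?free_wordP. Qed.

Lemma free_mulV : left_inverse free_one free_inv free_mul.
Proof.
move=> x; apply/val_inj => /=.
by rewrite -{1}(foldr_push0 (free_wordP x)) foldr_push_inv.
Qed.

Lemma free_mulrV : right_inverse free_one free_inv free_mul.
Proof.
move=> x; rewrite -[LHS]free_mul1 -(free_mulV (free_inv x)) -free_mulA.
by rewrite (free_mulA (free_inv x)) free_mulV free_mul1.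
Qed.

HB.instance Definition _ := isGroup.Build free_group
  free_mulA free_mul1 free_mulr1 free_mulV free_mulrV.

Definition gen (i : 'I_k) : free_group := @FreeGroup [:: (i, false)] isT.

Definition of_letter a : free_group := if a.2 then (gen a.1)^-1%g else gen a.1.

Lemma of_letterE a : free_word (of_letter a) = [:: a].
Proof. by case: a => i []. Qed.

Definition word_prod w : free_group := (\prod_(a <- w) of_letter a)%g.

Lemma word_prodE w : free_word (word_prod w) = foldr push [::] w.
Proof.
rewrite /word_prod; elim: w => [|a w IHw]; first by rewrite big_nil.
by rewrite big_cons /= -IHw [LHS]/(foldr push _ (of_letter a)) of_letterE.
Qed.

Lemma free_wordK (x : free_group) : word_prod x = x.
Proof. by apply/val_inj; rewrite /= word_prodE foldr_push0 ?free_wordP. Qed.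

Lemma wl_subproof (x : free_group) :
  exists n, [exists w : n.-tuple (letter k), word_prod w == x].
Proof.
exists (size (free_word x)); apply/existsP; exists (in_tuple x).
by rewrite /= free_wordK.
Qed.

(* Word length with respect to A_1^{+-1}, ..., A_k^{+-1}. *)
Definition wl (x : free_group) : nat := ex_minn (wl_subproof x).

Lemma size_push a s : (size (push a s) <= (size s).+1)%N.
Proof. by case: s => //= b s; case: ifP => // _; rewrite -addn2 leq_addr. Qed.

Lemma wlE (x : free_group) : wl x = size (free_word x).
Proof.
rewrite /wl; case: ex_minnP => n /existsP[w /eqP wx] nmin; apply/eqP.
rewrite eqn_leq nmin; last first.
  by apply/existsP; exists (in_tuple x); rewrite /= free_wordK.
rewrite -wx word_prodE -{2}(size_tuple w).
by elim: (tval w) => //= a s IHs; apply: leq_trans (size_push _ _) _.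
Qed.

(* The identity is regarded as cyclically reduced. *)
Definition cyclically_reduced (x : free_group) : bool :=
  if free_word x is a :: s then (of_letter a * of_letter (last a s) != 1)%g
  else true.

Definition log (j : 'I_k) (x : free_group) : int :=
  \sum_(a <- free_word x | a.1 == j) (-1) ^+ a.2.

Lemma logM j (x y : free_group) : log j (x * y)%g = log j x + log j y.
Proof.
rewrite /log [free_word (x * y)%g]/(foldr push y x).
elim: (free_word x) => [|a s IHs] /=; first by rewrite big_nil add0r.
rewrite [X in _ = X + _]big_cons.
set t := foldr push y s in IHs *.
have -> : \sum_(b <- push a t | b.1 == j) (-1) ^+ b.2 =
  (if a.1 == j then (-1) ^+ a.2 else 0) +
    \sum_(b <- t | b.1 == j) (-1) ^+ b.2 :> int.
  case: t {IHs} => [|b t] /=; first by rewrite big_cons; case: ifP; rewrite ?add0r.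
  case: eqP => [->|_]; last by rewrite big_cons; case: ifP; rewrite ?add0r.
  rewrite big_cons /=; case: ifP => _; last by rewrite add0r.
  by rewrite addrA; case: (a.2); rewrite /= ?addrN ?addNr add0r.
by rewrite IHs; case: ifP => _; rewrite ?addrA ?add0r.
Qed.

Lemma log_gen j i : log j (gen i) = (i == j)%:R.
Proof. by rewrite /log big_cons big_nil /=; case: ifP. Qed.

Definition Phi (x : free_group) : 'rV[int]_k := \row_j log j x.

Local Open Scope classical_set_scope.

Lemma finite_wl_le m : finite_set [set x : free_group | (wl x <= m)%N].
Proof.
pose f (n : 'I_m.+1) (w : n.-tuple (letter k)) := word_prod w.
apply: (@sub_finite_set _ _
  (\bigcup_(n in [set: 'I_m.+1]) [set f n w | w in [set: n.-tuple (letter k)]])).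
  move=> x /=; rewrite wlE -ltnS => hx; exists (Ordinal hx) => //.
  by exists (in_tuple x) => //; rewrite /f /= free_wordK.
by apply: bigcup_finite => // n _; apply: finite_image.
Qed.

(* [fset_set] yields the empty set on infinite sets; by [finite_wl_le] the two
   sets counted below are always finite. *)
Definition n_count (beta : 'rV[int]_k) (m : nat) : nat :=
  #|` fset_set [set x : free_group |
        [/\ cyclically_reduced x, wl x = m & Phi x = beta]] |%fset.

Definition N_count (beta : 'rV[int]_k) (m : nat) : nat :=
  #|` fset_set [set x : free_group |
        [/\ cyclically_reduced x, (wl x <= m)%N & Phi x = beta]] |%fset.

End FreeGroup.

Section Quantities.
Variables (R : realType) (k : nat).

Definition inner (beta : 'rV[int]_k) : R := (\sum_i beta 0 i * beta 0 i)%:~R.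

Definition parity_factor (m : nat) (beta : 'rV[int]_k) : R :=
  1 + (-1) ^ (m%:Z + \sum_i beta 0 i).

End Quantities.

(* Main.v *)
Require Import Defs.
From mathcomp Require Import all_boot all_order all_algebra.
From mathcomp Require Import finmap.
From mathcomp Require Import all_classical all_reals all_analysis.
From mathcomp Require Import ring lra zify.

Set Implicit Arguments.
Unset Strict Implicit.
Unset Printing Implicit Defensive.

Import Order.TTheory GRing.Theory Num.Theory.
Import numFieldNormedType.Exports.

Local Open Scope classical_set_scope.
Local Open Scope ring_scope.

(* Peeling letters off reduced words shows that the character sum over the
   cyclically reduced words of length [m], at angles [x], is
   [l^m + l'^m + (k - 1) (1 + (-1)^m)], where [l] and [l'] are the roots of
   [X^2 - 2 c X + q] and [c = sum_j cos x_j].  Since all counts are even in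
   each coordinate, products of cosines serve as characters, and averages over
   the grid [(2 pi / M) {0, .., M-1}^k] with [M] large replace integrals over
   the torus.

   Instead of a Gaussian integral, the comparison law is the product [P] of
   [k] centred binomials [C(2N, N + b) / 4^N] with [N = 2 m / (k - 1)], whose
   transform is the product of the [((1 + cos x_j) / 2)^N].  In terms of
   [u_j = 1 - cos x_j] and [s = sum_j u_j], both [(l/q)^m] and the transform of
   [P] are [exp (- m s / (k - 1))] up to [O(exp (- c m s) / m)] for [s <= k];
   the half [s >= k] is symmetric under [x -> x + pi] and produces the parity
   factor.  Averaging over the grid gains a factor [O(m^(-k/2))], so the count divided
   by [q^m] is the parity factor times [P] up to [O(m^(-k/2 - 1))].  The
   de Moivre-Laplace theorem for central binomials, with the constant given by
   Wallis' product, ends the first half with rate [O(m^(-1/2))].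

   For the second half, the normalised average of two consecutive cumulative
   counts satisfies a recursion in [m] that contracts by about [1 / q], driven
   by sums of two consecutive exact counts, in which the parity factors add
   up to 2. *)

(** * Counting reduced and cyclically reduced words *)

Section Words.
Variables (k : nat) (R : realType).
Implicit Types (a b : letter k) (w : seq (letter k)) (beta : 'rV[int]_k).

(** All words are listed, reduced or not. The conditions enter the sums below as 0/1 factors, so
    that adding or removing a letter is a mere exchange of sums. *)
Fixpoint words (m : nat) : seq (seq (letter k)) :=
  if m is m'.+1 then [seq a :: w | a <- enum (letter k), w <- words m']
  else [:: [::]].

Lemma mem_words m w : (w \in words m) = (size w == m).
Proof.
elim: m w => [|m IHm] [|a w] //=.
  by apply/negP => /allpairsP[] [] b v [].
rewrite eqSS -IHm; apply/allpairsP/idP => [[] [] b v [] _ /= vm [_ ->] //|wm].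
by exists (a, w); rewrite mem_enum.
Qed.

Lemma uniq_words m : uniq (words m).
Proof.
elim: m => //= m IHm; apply: allpairs_uniq => //; first exact: enum_uniq.
by move=> [a v] [b w] _ _ [-> ->].
Qed.

Lemma sum_wordsS m (F : seq (letter k) -> R) :
  \sum_(w <- words m.+1) F w = \sum_a \sum_(w <- words m) F (a :: w).
Proof. by rewrite /= big_allpairs_dep big_enum. Qed.

Lemma sum_words_rcons m (F : seq (letter k) -> R) :
  \sum_(w <- words m.+1) F w = \sum_(w <- words m) \sum_a F (rcons w a).
Proof.
elim: m F => [|m IHm] F.
  by rewrite sum_wordsS big_seq1; apply: eq_bigr => a _; rewrite big_seq1.
by rewrite sum_wordsS sum_wordsS; apply: eq_bigr => a _; rewrite IHm.
Qed.

Definition letter_vec a : 'rV[int]_k := (-1) ^+ a.2 *: delta_mx 0 a.1.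

Definition phi w : 'rV[int]_k := \sum_(a <- w) letter_vec a.

Lemma PhiE (x : free_group k) : Phi x = phi (free_word x).
Proof.
apply/rowP => j; rewrite !mxE /log /phi summxE big_mkcond.
apply: eq_bigr => a _; rewrite !mxE eqxx /=.
by case: (eqVneq a.1 j) => [_|_]; rewrite ?mulr1 ?mulr0.
Qed.

Lemma letter_vec_inv a : letter_vec (inv_letter a) = - letter_vec a.
Proof.
by rewrite /letter_vec /=; case: (a.2); rewrite /= ?expr0 ?expr1 scaleN1r scale1r ?opprK.
Qed.

Lemma phi_cons a w : phi (a :: w) = letter_vec a + phi w.
Proof. by rewrite /phi big_cons. Qed.

Lemma phi_rcons w a : phi (rcons w a) = phi w + letter_vec a.
Proof. by rewrite /phi -cats1 big_cat big_seq1. Qed.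

Definition cyc w := if w is a :: s then last a s != inv_letter a else true.

Lemma cyclically_reducedE (x : free_group k) :
  cyclically_reduced x = cyc (free_word x).
Proof.
rewrite /cyclically_reduced /cyc; case: (free_word x) => // a s.
congr (~~ _); set b := last a s; apply/eqP/eqP => [|->].
  by move/(congr1 (@free_word k)) => /=; rewrite !of_letterE /=; case: eqP.
by apply/val_inj; rewrite /= !of_letterE /= eqxx.
Qed.

Definition reduced_count m beta : R :=
  \sum_(w <- words m) (reduced w && (phi w == beta))%:R.

Definition cyc_count m beta : R :=
  \sum_(w <- words m) [&& reduced w, cyc w & phi w == beta]%:R.

Lemma sum_neq_letter b : \sum_a (a != b)%:R = 2 * k%:R - 1 :> R.
Proof.
transitivity (\sum_a (1 - (a == b)%:R) : R).
  by apply: eq_bigr => a _; case: (a == b); rewrite ?subrr ?subr0.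
rewrite sumrB [X in _ - X](bigD1 b) //= eqxx [X in _ - (_ + X)]big1 => [|a /negPf->//].
by rewrite big_const iter_addr card_prod card_ord card_bool natrM addr0 mulrC addr0.
Qed.

Lemma inv_letter_neq a b : (b != inv_letter a) = (a != inv_letter b).
Proof. by rewrite -(inj_eq (inv_inj (@inv_letterK k))) inv_letterK eq_sym. Qed.

Lemma sum_reduced_cons w :
  \sum_a (reduced (a :: w))%:R =
    (2 * k%:R - (~~ nilp w)%:R) * (reduced w)%:R :> R.
Proof.
case: w => [|b w].
  rewrite /= subr0 mulr1 big_const iter_addr addr0.
  by rewrite card_prod card_ord card_bool natrM mulrC.
rewrite -(sum_neq_letter (inv_letter b)) mulr_suml; apply: eq_bigr => a _.
by rewrite /reduced /= inv_letter_neq -natrM mulnb.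
Qed.

Lemma reduced_count0 beta : reduced_count 0 beta = (beta == 0)%:R.
Proof. by rewrite /reduced_count big_seq1 /phi big_nil eq_sym. Qed.

Lemma reduced_count1 beta :
  reduced_count 1 beta = \sum_a reduced_count 0 (beta - letter_vec a).
Proof.
rewrite /reduced_count sum_wordsS; apply: eq_bigr => a _.
by rewrite !big_seq1 /= phi_cons [in RHS]eq_sym subr_eq [_ + letter_vec a]addrC eq_sym.
Qed.

(** Put a letter [a] before a reduced word of length [m.+1]. The result is reduced unless the word
    begins with the inverse of [a]; then it cancels to a reduced [w] of length [m]. A given [w]
    arises from [2k - 1] letters [a], or from all [2k] if it is empty, whence the term [m != 0]. *)
Lemma reduced_countSS m beta :
  reduced_count m.+2 beta = \sum_a reduced_count m.+1 (beta - letter_vec a)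
    - (2 * k%:R - (m != 0)%:R) * reduced_count m beta.
Proof.
apply/eqP; rewrite eq_sym subr_eq eq_sym; apply/eqP.
have -> : (2 * k%:R - (m != 0)%:R) * reduced_count m beta =
    \sum_a \sum_(w <- words m)
      (reduced (inv_letter a :: w) && (phi w == beta))%:R.
  rewrite exchange_big /reduced_count mulr_sumr; apply: eq_big_seq => w.
  rewrite mem_words => /eqP <-.
  rewrite (reindex_inj (inv_inj (@inv_letterK k))).
  under eq_bigr => a _ do rewrite inv_letterK -mulnb natrM.
  rewrite -mulr_suml sum_reduced_cons -mulrA; congr (_ * _).
  by rewrite -natrM mulnb.
rewrite {1}/reduced_count sum_wordsS -big_split; apply: eq_bigr => a _.
rewrite -[LHS]/(_ + _).
rewrite /reduced_count !sum_wordsS.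
(* The cancelling pairs are spread over a sum in [b] supported on [b = inv_letter a], so that the
   identity can be checked for each [a], [b] and [w] separately. *)
rewrite [X in _ + X](_ : _ = \sum_b \sum_(w <- words m)
  ((b == inv_letter a) && (reduced (b :: w) && (phi w == beta)))%:R); last first.
  rewrite [RHS](bigD1 (inv_letter a)) //= [X in _ = _ + X]big1 ?addr0 => [|b /negPf nb].
    by apply: eq_bigr => w _; rewrite eqxx.
  by rewrite big1 // => w _; rewrite nb.
rewrite -big_split /=; apply: eq_bigr => b _.
rewrite -big_split /=; apply: eq_bigr => w _.
have -> : (phi (b :: w) == beta - letter_vec a) = (phi [:: a, b & w] == beta).
  by rewrite [in LHS]eq_sym subr_eq [_ + letter_vec a]addrC -phi_cons eq_sym.
case: (eqVneq b (inv_letter a)) => [->|_] /=; last by rewrite addr0.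
by rewrite add0r !phi_cons letter_vec_inv addrA subrr add0r.
Qed.

Lemma cyc_count1 beta : cyc_count 1 beta = reduced_count 1 beta.
Proof.
rewrite /cyc_count /reduced_count !sum_wordsS; apply: eq_bigr => a _.
rewrite !big_seq1 /=; suff -> : a != inv_letter a by [].
by case: a => i []; apply/eqP => -[].
Qed.

(** A reduced word of length [m.+2] that is not cyclically reduced has the form [a w a^-1], and the
    contributions of [a] and its inverse to [phi] cancel. *)
Lemma cyc_countSS m beta :
  cyc_count m.+2 beta = reduced_count m.+2 beta -
   \sum_(w <- words m) (phi w == beta)%:R *
     \sum_a (reduced (a :: rcons w (inv_letter a)))%:R.
Proof.
apply/eqP; rewrite eq_sym subr_eq eq_sym; apply/eqP.
rewrite /cyc_count /reduced_count !(sum_wordsS m.+1).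
under eq_bigr => a _ do rewrite sum_words_rcons.
under [in RHS]eq_bigr => a _ do rewrite sum_words_rcons.
under [X in _ + X = _]eq_bigr => w _ do rewrite mulr_sumr.
rewrite [X in _ + X = _]exchange_big -big_split /=; apply: eq_bigr => a _.
rewrite -big_split /=; apply: eq_bigr => w _.
rewrite (bigD1 (inv_letter a)) //= [in RHS](bigD1 (inv_letter a)) //=.
rewrite addrAC; congr (_ + _); last first.
  by apply: eq_bigr => b nb; rewrite last_rcons nb.
rewrite last_rcons eqxx /= andbF add0r -natrM mulnb andbC.
by rewrite phi_cons phi_rcons letter_vec_inv addrCA addrN addr0.
Qed.

Lemma cyc_count2 beta : cyc_count 2 beta = reduced_count 2 beta.
Proof.
rewrite cyc_countSS big_seq1 [X in _ - _ * X]big1 ?mulr0 ?subr0 // => a _.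
by rewrite /reduced /= eqxx.
Qed.

(** For [w] reduced and nonempty, [a w a^-1] is reduced when [a] differs from the last letter of [w]
    and from the inverse of its first letter. These two forbidden letters coincide exactly when [w]
    is not cyclically reduced, so [2k - 1 - [cyc w]] letters remain. *)
Lemma cyc_countSSS m beta :
  cyc_count m.+3 beta = cyc_count m.+1 beta + reduced_count m.+3 beta
    - (2 * k%:R - 1) * reduced_count m.+1 beta.
Proof.
rewrite cyc_countSS -addrA [RHS]addrC -[RHS]addrA; congr (_ + _).
apply: oppr_inj; rewrite opprK opprD opprK.
rewrite /reduced_count mulr_sumr /cyc_count -sumrB.
apply: eq_big_seq => -[|h t]; first by rewrite mem_words.
move=> _; set l := last h t.
have E a : reduced (a :: rcons (h :: t) (inv_letter a)) =
  [&& reduced (h :: t), a != inv_letter h & a != l].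
  rewrite /reduced /= rcons_path -/l inv_letter_neq.
  by rewrite (inj_eq (inv_inj (@inv_letterK k))) andbCA.
under eq_bigr => a _ do rewrite E -mulnb natrM.
rewrite -mulr_sumr mulrA -natrM mulnb.
have -> : \sum_a ((a != inv_letter h) && (a != l))%:R
    = 2 * k%:R - 1 - (l != inv_letter h)%:R :> R.
  rewrite -(sum_neq_letter (inv_letter h)) (bigD1 l) //= [in RHS](bigD1 l) //=.
  rewrite eqxx andbF add0r [RHS]addrAC subrr add0r.
  by apply: eq_bigr => a ->; rewrite andbT.
rewrite -/(cyc (h :: t)) mulrBr mulrC [in LHS](andbC (phi _ == _)); congr (_ - _).
by rewrite -natrM mulnb -andbA [(phi _ == _) && _]andbC.
Qed.

(** [pmap insub] keeps exactly the reduced words and turns them into group elements without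
    repetition, so the cardinal of the set is a count in the list [words m]. *)
Lemma card_fset_words m (P : pred (seq (letter k))) :
  (#|` fset_set [set x : free_group k | P (free_word x) /\ wl x = m] |%fset)%:R =
    \sum_(w <- words m) (reduced w && P w)%:R :> R.
Proof.
pose s : seq (free_group k) := pmap insub [seq w <- words m | P w].
have us : uniq s by rewrite pmap_sub_uniq // filter_uniq // uniq_words.
have -> : fset_set [set x : free_group k | P (free_word x) /\ wl x = m] = seq_fset tt s.
  have fs : finite_set [set x : free_group k | P (free_word x) /\ wl x = m].
    by apply: sub_finite_set (finite_wl_le k m) => x [_ /= ->].
  apply/fsetP => x; rewrite in_fset_set // seq_fsetE.
  rewrite /s mem_pmap_sub mem_filter mem_words.
  by apply/idP/andP => [/set_mem [] Px <-|[Px /eqP mx]];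
    [rewrite wlE | apply/mem_set; split; rewrite ?wlE].
rewrite size_seq_fset undup_id // size_pmap_sub.
rewrite count_filter -sum1_count natr_sum big_mkcond /=.
by apply: eq_bigr => w _; case: (_ && _).
Qed.

Lemma n_countE m beta : (n_count beta m)%:R = cyc_count m beta.
Proof.
apply: etrans (card_fset_words m (fun w => cyc w && (phi w == beta))).
congr (#|` fset_set _|%fset)%:R; apply/seteqP; split=> x /=.
  by case; rewrite cyclically_reducedE => -> -> <-; rewrite PhiE eqxx.
by case=> /andP[cx /eqP <-] ->; rewrite cyclically_reducedE PhiE.
Qed.

Lemma N_countS m beta : N_count beta m.+1 = (N_count beta m + n_count beta m.+1)%N.
Proof.
have fin (A : set (free_group k)) j : (A `<=` [set x | (wl x <= j)%N]) -> finite_set A.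
  by move=> sA; apply: sub_finite_set sA (finite_wl_le k j).
have f1 : finite_set [set x : free_group k |
   [/\ cyclically_reduced x, (wl x <= m)%N & Phi x = beta]].
  by apply: (fin _ m) => x [].
have f2 : finite_set [set x : free_group k |
   [/\ cyclically_reduced x, wl x = m.+1 & Phi x = beta]].
  by apply: (fin _ m.+1) => x [_ /= -> _].
rewrite /N_count /n_count.
rewrite (_ : [set x | [/\ _, (_ <= m.+1)%N & _]] =
  [set x : free_group k | [/\ cyclically_reduced x, (wl x <= m)%N & Phi x = beta]]
  `|` [set x | [/\ cyclically_reduced x, wl x = m.+1 & Phi x = beta]]).
  rewrite fset_setU // cardfsU (_ : (_ `&` _)%fset = fset0) ?cardfs0 ?subn0 //.
  apply/fsetP => x; rewrite inE !in_fset_set // in_fset0; apply/negP.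
  by move=> /andP[/set_mem [_ h _] /set_mem [_ E _]]; rewrite E ltnn in h.
apply/seteqP; split=> x /=.
  case=> cx; rewrite leq_eqVlt ltnS => /orP[/eqP E|h] Px; by [right|left].
by case=> -[cx h Px]; split=> //; [exact: leqW | rewrite h].
Qed.

End Words.

(** * Averages over a grid of angles *)

Section Grid.
Variable R : realType.

Definition angle (M : nat) (t : 'I_M) : R := 2 * pi * t%:R / M%:R.

Definition avg1 (M : nat) (f : R -> R) : R :=
  M%:R^-1 * \sum_(t < M) f (angle t).

Lemma eq_avg1 M f g : f =1 g -> avg1 M f = avg1 M g.
Proof. by move=> fg; congr (_ * _); apply: eq_bigr => t _; rewrite fg. Qed.

Lemma avg1D M f g : avg1 M (fun x => f x + g x) = avg1 M f + avg1 M g.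
Proof. by rewrite /avg1 big_split mulrDr. Qed.

Lemma avg1Z M a f : avg1 M (fun x => a * f x) = a * avg1 M f.
Proof. by rewrite /avg1 -mulr_sumr mulrCA. Qed.

Lemma ler_avg1 M f g : (forall x, f x <= g x) -> avg1 M f <= avg1 M g.
Proof. by move=> fg; rewrite ler_wpM2l ?invr_ge0// ler_sum. Qed.

Lemma avg1_cst M a : (0 < M)%N -> avg1 M (fun=> a) = a.
Proof.
move=> M0; rewrite /avg1 sumr_const card_ord -[a *+ M]mulr_natr mulrCA mulVf ?mulr1 //.
by rewrite pnatr_eq0 -lt0n.
Qed.

(** The sum telescopes, as [2 sin h cos (2 h t) = sin ((2 t + 1) h) - sin ((2 t - 1) h)]. *)
Lemma sum_cos_arith (h : R) n :
  (\sum_(t < n) cos (2 * h * t%:R)) * (2 * sin h) = sin (h * (2 * n%:R - 1)) + sin h.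
Proof.
elim: n => [|n IHn].
  by rewrite big_ord0 mul0r mulr0 sub0r mulrN mulr1 sinN addNr.
rewrite big_ord_recr /= mulrDl IHn.
rewrite (_ : h * (2 * n.+1%:R - 1) = 2 * h * n%:R + h); last by rewrite -natr1; ring.
rewrite (_ : h * (2 * n%:R - 1) = 2 * h * n%:R - h); last by ring.
by rewrite sinB sinD; ring.
Qed.

Lemma avg_cos_nat M n : (0 < n < M)%N -> avg1 M (fun x => cos (x * n%:R)) = 0.
Proof.
move=> /andP[n0 nM].
have Mp : 0 < M%:R :> R by rewrite ltr0n (leq_trans n0 (ltnW nM)).
have M0 : M%:R != 0 :> R by rewrite gt_eqF.
pose h : R := pi * n%:R / M%:R.
have h0 : 0 < h < pi.
  rewrite /h divr_gt0 ?mulr_gt0 ?pi_gt0 //= ?ltr0n //.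
  by rewrite ltr_pdivrMr // ltr_pM2l ?pi_gt0 // ltr_nat.
have s0 : 2 * sin h != 0 by rewrite mulf_neq0 // gt_eqF // sin_gt0_pi.
rewrite /avg1; apply/eqP; rewrite mulf_eq0 invr_eq0 (negPf M0) /=.
rewrite -(inj_eq (mulIf s0)) mul0r.
rewrite (_ : \sum_(t < M) _ = \sum_(t < M) cos (2 * h * t%:R)); last first.
  apply: eq_bigr => t _; congr cos; rewrite /angle /h; field.
  exact: M0.
(* Since [h M = pi n], the end point is [- h] up to [n] full periods, and the two sines cancel. *)
rewrite sum_cos_arith (_ : h * (2 * M%:R - 1) = - h + pi *+ 2 *+ n); last first.
  rewrite /h -[pi *+ 2 *+ n]mulr_natr -[pi *+ 2]mulr_natr; field.
  exact: M0.
by rewrite (periodicn (@sinD2pi R)) sinN addNr.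
Qed.

Lemma avg_cos M (b : int) : (`|b| < M)%N ->
  avg1 M (fun x => cos (x * b%:~R)) = (b == 0)%:R.
Proof.
move=> bM; have [->|b0] := eqVneq b 0.
  under eq_avg1 => x do rewrite mulr0 cos0.
  by rewrite avg1_cst // (leq_ltn_trans _ bM).
rewrite -[RHS](@avg_cos_nat M `|b|); last by rewrite bM absz_gt0 b0.
apply: eq_avg1 => x; case: b {bM b0} => n //=.
by rewrite NegzE mulrNz mulrN cosN.
Qed.

Lemma cos_shift (x : R) (b : int) :
  cos (x * (b + 1)%:~R) + cos (x * (b - 1)%:~R) = 2 * cos x * cos (x * b%:~R).
Proof. by rewrite intrD intrB !mulr1z mulrDr mulrBr mulr1 cosD cosB; ring. Qed.

(** The law of a sum of [N] independent steps -1, 0, 1 of weights 1/4, 1/2, 1/4, that is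
    [C(2N, N + b) / 4^N]. The recursion is the one that multiplication by [(1 + cos x) / 2] induces
    on Fourier coefficients. *)
Fixpoint pbin (N : nat) (b : int) : R :=
  if N is N'.+1 then (pbin N' (b - 1) + 2 * pbin N' b + pbin N' (b + 1)) / 4
  else (b == 0)%:R.

(** Each factor [(1 + e cos x) / 2] acts on frequencies as one step of [pbin]. The sign [e = -1]
    amounts to the shift [x -> x + pi] and produces [(-1)^b]. The bound on [M] keeps every frequency
    met in the induction below [M], where distinct frequencies are told apart by the grid. *)
Lemma avg_pbin (e : R) M N b : e * e = 1 -> (N + `|b| < M)%N ->
  avg1 M (fun x => ((1 + e * cos x) / 2) ^+ N * cos (x * b%:~R)) = e ^ b * pbin N b.
Proof.
move=> ee; have ue : e \is a GRing.unit by apply/unitrPr; exists e.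
have eV : e^-1 = e by apply: (mulrI ue); rewrite divrr.
elim: N b => [|N IHN] b bM.
  under eq_avg1 => x do rewrite expr0 mul1r.
  by rewrite avg_cos //=; case: eqP => [->|]; rewrite ?mulr0 // expr0z mulr1.
under eq_avg1 => x.
  rewrite (_ : _ * _ = 2^-1 * (((1 + e * cos x) / 2) ^+ N * cos (x * b%:~R)) +
    e / 4 * (((1 + e * cos x) / 2) ^+ N * cos (x * (b + 1)%:~R)
     + ((1 + e * cos x) / 2) ^+ N * cos (x * (b - 1)%:~R))); last first.
    by rewrite exprS -mulrDr cos_shift; field.
  over.
rewrite avg1D !avg1Z avg1D !IHN; try by lia.
have e0 : e != 0 by rewrite -unitfE.
have -> : e ^ (b + 1) = e ^ b * e by rewrite expfzDr // expr1z.
have -> : e ^ (b - 1) = e ^ b * e by rewrite expfzDr // exprN1 eV.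
rewrite /= (_ : e / 4 * _ = (e * e) * (e ^ b / 4 * (pbin N (b + 1) + pbin N (b - 1)))).
  by rewrite ee; field.
by field.
Qed.

End Grid.

(** * Grid averages in [k] dimensions and character sums over words *)

Section MultiGrid.
Variables (k : nat) (R : realType).
Implicit Types (x : 'I_k -> R) (beta : 'rV[int]_k).

Definition avg (M : nat) (F : ('I_k -> R) -> R) : R :=
  M%:R^-1 ^+ k * \sum_(t : {ffun 'I_k -> 'I_M}) F (fun j => angle R (t j)).

Lemma eq_avg M F G : F =1 G -> avg M F = avg M G.
Proof. by move=> FG; congr (_ * _); apply: eq_bigr => t _; rewrite FG. Qed.

Lemma avgD M F G : avg M (fun x => F x + G x) = avg M F + avg M G.
Proof. by rewrite /avg big_split mulrDr. Qed.

Lemma avgZ M a F : avg M (fun x => a * F x) = a * avg M F.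
Proof. by rewrite /avg -mulr_sumr mulrCA. Qed.

Lemma avgB M F G : avg M (fun x => F x - G x) = avg M F - avg M G.
Proof. by rewrite /avg sumrB mulrBr. Qed.

Lemma avg_sum (I : finType) M (F : I -> ('I_k -> R) -> R) :
  avg M (fun x => \sum_i F i x) = \sum_i avg M (F i).
Proof. by rewrite /avg exchange_big mulr_sumr. Qed.

Lemma ler_avg M F G : (forall x, F x <= G x) -> avg M F <= avg M G.
Proof. by move=> FG; rewrite ler_wpM2l ?exprn_ge0 ?invr_ge0// ler_sum. Qed.

Lemma ler_norm_avg M F : `|avg M F| <= avg M (fun x => `|F x|).
Proof.
by rewrite normrM ger0_norm ?exprn_ge0 ?invr_ge0 // ler_wpM2l ?exprn_ge0 ?invr_ge0 // ler_norm_sum.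
Qed.

Lemma avg_prod M (f : 'I_k -> R -> R) :
  avg M (fun x => \prod_j f j (x j)) = \prod_j avg1 M (f j).
Proof.
rewrite big_split /= prodr_const card_ord; congr (_ * _).
by rewrite bigA_distr_bigA.
Qed.

Definition chi x beta : R := \prod_j cos (x j * (beta 0 j)%:~R).

Definition cos_sum x : R := \sum_j cos (x j).

Definition norm1 beta : nat := (\sum_j `|beta 0%R j|%N)%N.

Lemma norm1_letter beta a : (norm1 (beta - letter_vec a) <= (norm1 beta).+1)%N.
Proof.
rewrite /norm1 (bigD1 a.1) //= [X in (_ <= X.+1)%N](bigD1 a.1) //= -addSn.
apply: leq_add.
  rewrite !mxE !eqxx; move: (beta 0 a.1) => b.
  by case: (a.2); rewrite /= ?expr0 ?expr1 mulr1; lia.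
apply: leq_sum => j ja; rewrite !mxE eqxx (negPf ja) mulr0 subr0.
exact: leqnn.
Qed.

(** The letters [A_i] and [A_i^-1] shift the [i]-th frequency by one in both directions, and
    [cos_shift] merges the two terms. *)
Lemma sum_chi_letter x beta :
  \sum_a chi x (beta - letter_vec a) = 2 * cos_sum x * chi x beta.
Proof.
rewrite -(pair_bigA _ (fun i e => chi x (beta - letter_vec (i, e)))) /=.
rewrite /cos_sum mulr_sumr mulr_suml; apply: eq_bigr => i _.
rewrite big_bool /chi (bigD1 i) //= [in X in _ + X](bigD1 i) //=.
rewrite [in RHS](bigD1 i) //= mulrA -cos_shift mulrDl !mxE !eqxx !mulr1 expr0 expr1 opprK.
by congr (_ * _ + _ * _); apply: eq_bigr => j ja; rewrite !mxE eqxx (negPf ja) mulr0 subr0.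
Qed.

Lemma avg_chi M beta : (norm1 beta < M)%N -> avg M (chi ^~ beta) = (beta == 0)%:R.
Proof.
move=> bM.
rewrite [LHS](avg_prod M (fun j y => cos (y * (beta 0 j)%:~R))).
have [->|/eqP b0] := eqVneq beta 0.
  rewrite big1 // => j _; rewrite avg_cos ?mxE ?eqxx //.
  by apply: leq_ltn_trans bM.
have [j bj] : exists j, beta 0 j != 0.
  apply: contrapT => nb; apply: b0; apply/rowP => j; rewrite mxE.
  by apply/eqP/negPn/negP => bj; apply: nb; exists j.
rewrite (bigD1 j) //= avg_cos ?(negPf bj) ?mul0r //.
by apply: leq_ltn_trans bM; rewrite /norm1 (bigD1 j) //= leq_addr.
Qed.

(* [rpol y m] and [cpol y m] are the sums of a character over the reduced and
   the cyclically reduced words of length [m], with [y] its sum over letters. *)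
Fixpoint rpol (y : R) (m : nat) : R :=
  match m with
  | 0 => 1
  | m'.+1 => match m' with
     | 0 => y
     | m''.+1 => y * rpol y m' - (2 * k%:R - (m'' != 0)%:R) * rpol y m''
     end
  end.

Fixpoint cpol (y : R) (m : nat) : R :=
  match m with
  | 0 => 1
  | 1 => y
  | 2 => rpol y 2
  | (m''.+1 as m').+2 =>
      cpol y m' + rpol y m - (2 * k%:R - 1) * rpol y m'
  end.

(** Both sides satisfy the recursion of [reduced_countSS], so two consecutive lengths are carried
    through the induction. Moving by a letter raises [norm1 beta] by at most one while [m] drops by
    one, so the condition on [M] persists. *)
Lemma reduced_count_avg M m beta : (norm1 beta + m < M)%N ->
  reduced_count R m beta = avg M (fun x => rpol (2 * cos_sum x) m * chi x beta).
Proof.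
suff H : forall beta, ((norm1 beta + m < M)%N ->
    reduced_count R m beta = avg M (fun x => rpol (2 * cos_sum x) m * chi x beta))
  /\ ((norm1 beta + m.+1 < M)%N ->
    reduced_count R m.+1 beta = avg M (fun x => rpol (2 * cos_sum x) m.+1 * chi x beta)).
  exact: (H beta).1.
elim: m {beta} => [|m IHm] beta; split => bM.
- rewrite reduced_count0 -(@avg_chi M) //; last by rewrite addn0 in bM.
  by apply: eq_avg => x; rewrite mul1r.
- rewrite reduced_count1 /=.
  under [RHS]eq_avg => x do rewrite -sum_chi_letter.
  rewrite avg_sum; apply: eq_bigr => a _; rewrite reduced_count0 avg_chi //.
  by have := norm1_letter beta a; lia.
- by apply: (IHm beta).2.
- rewrite reduced_countSS (IHm beta).1; last by lia.
  have -> : \sum_a reduced_count R m.+1 (beta - letter_vec a) = \sum_a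
      avg M (fun x => rpol (2 * cos_sum x) m.+1 * chi x (beta - letter_vec a)).
    apply: eq_bigr => a _; rewrite (IHm _).2 //.
    by have := norm1_letter beta a; lia.
  rewrite -avg_sum -avgZ -avgB; apply: eq_avg => x.
  by rewrite -mulr_sumr sum_chi_letter /=; ring.
Qed.

Lemma cpolSSS y m :
  cpol y m.+3 = cpol y m.+1 + rpol y m.+3 - (2 * k%:R - 1) * rpol y m.+1.
Proof. by []. Qed.

Lemma cyc_count_avg M m beta : (norm1 beta + m < M)%N -> (0 < m)%N ->
  cyc_count R m beta = avg M (fun x => cpol (2 * cos_sum x) m * chi x beta).
Proof.
elim/ltn_ind: m => -[//|[|[|m]]] IHm bM _.
- by rewrite cyc_count1 (reduced_count_avg bM).
- by rewrite cyc_count2 (reduced_count_avg bM).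
rewrite cyc_countSSS (IHm m.+1) //; last by lia.
rewrite (reduced_count_avg bM) (@reduced_count_avg M m.+1); last by lia.
rewrite -avgD -avgZ -avgB; apply: eq_avg => x.
by rewrite cpolSSS; ring.
Qed.

(** Dickson polynomials of the first kind: the power sums of the two roots of [X^2 - y X + q]. *)
Fixpoint dickson (q y : R) (m : nat) : R :=
  match m with
  | 0 => 2
  | m'.+1 => match m' with
     | 0 => y
     | m''.+1 => y * dickson q y m' - q * dickson q y m''
     end
  end.

Lemma rpolSSS y m :
  rpol y m.+3 = y * rpol y m.+2 - (2 * k%:R - 1) * rpol y m.+1.
Proof. by []. Qed.

Lemma dicksonSS q y m :
  dickson q y m.+2 = y * dickson q y m.+1 - q * dickson q y m.
Proof. by []. Qed.

(** By [DR], the increments of [cpol] and [dickson] from [m.+1] to [m.+3] agree. Their difference is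
    thus 2-periodic, and the lengths 1 and 2 give its values 0 and [2 (k - 1)]. *)
Lemma cpolE y m : cpol y m.+1 =
  dickson (2 * k%:R - 1) y m.+1 + (k%:R - 1) * (1 + (-1) ^+ m.+1).
Proof.
set q := 2 * k%:R - 1.
have DR j : dickson q y j.+3 - dickson q y j.+1 = rpol y j.+3 - q * rpol y j.+1.
  suff [] : (dickson q y j.+3 - dickson q y j.+1 = rpol y j.+3 - q * rpol y j.+1)
    /\ (dickson q y j.+4 - dickson q y j.+2 = rpol y j.+4 - q * rpol y j.+2) by [].
  elim: j => [|j [IH1 IH2]]; first by split; rewrite /= /q; ring.
  split=> //.
  transitivity (y * (dickson q y j.+4 - dickson q y j.+2)
      - q * (dickson q y j.+3 - dickson q y j.+1)).
    rewrite (dicksonSS q y j.+3) (dicksonSS q y j.+1).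
    set d4 := dickson _ _ _; set d2 := dickson _ _ _; set d1 := dickson _ _ _.
    ring.
  rewrite IH1 IH2 (rpolSSS y j.+2) (rpolSSS y j) -/q.
  set r4 := rpol _ _; set r2 := rpol _ _; set r1 := rpol _ _.
  ring.
elim/ltn_ind: m => -[|[|m]] IHm.
- by rewrite /= expr1 subrr mulr0 addr0.
- by rewrite /= expr2 mulrNN mulr1 /q; ring.
- rewrite cpolSSS (IHm m) // -/q.
  rewrite (_ : dickson q y m.+3 = dickson q y m.+1 + (rpol y m.+3 - q * rpol y m.+1)).
    by rewrite !exprS; ring.
  by rewrite -DR; ring.
Qed.

End MultiGrid.

(** * Central binomial probabilities *)

Section CentralBinomial.
Variable R : realType.
Local Notation pbin := (@pbin R).

Lemma pbinN N b : pbin N (- b) = pbin N b.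
Proof.
elim: N b => [|N IHN] b /=; first by rewrite oppr_eq0.
rewrite -opprD IHN (_ : - b + 1 = - (b - 1)) ?IHN; last by rewrite opprB addrC.
by rewrite addrC addrA [in RHS]addrC -!addrA; congr (_ / _); ring.
Qed.

Lemma pbin_nat N n : pbin N n%:Z = 'C(2 * N, N + n)%:R / 4 ^+ N.
Proof.
elim: N n => [|N IHN] n; first by rewrite muln0 add0n bin0n expr0 divr1; case: n.
rewrite exprS (_ : (2 * N.+1 = (2 * N).+2)%N); last by lia.
case: n => [|n].
  rewrite [LHS]/= sub0r pbinN add0r -[pbin N 1]/(pbin N 1%N%:Z) !IHN !addn0.
  have -> : ('C((2 * N).+2, N.+1) = 2 * ('C(2 * N, N + 1) + 'C(2 * N, N)))%N.
    rewrite binS; have -> : 'C((2 * N).+1, N) = 'C((2 * N).+1, N.+1).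
      by rewrite -bin_sub; [congr 'C(_, _); lia | lia].
    by rewrite binS addn1; lia.
  rewrite natrM natrD; field.
  by rewrite expf_neq0.
rewrite [LHS]/= (_ : n.+1%:Z - 1 = n%:Z); last by lia.
rewrite (_ : n.+1%:Z + 1 = n.+2%:Z); last by lia.
rewrite !IHN (_ : (N.+1 + n.+1 = (N + n).+2)%N) ?addnS; last by lia.
rewrite !binS !natrD; field.
by rewrite expf_neq0.
Qed.

Lemma pbin_abs N b : pbin N b = pbin N `|b|%:Z.
Proof. by case: b => n //; rewrite NegzE pbinN abszN. Qed.

Lemma pbin_ge0 N b : 0 <= pbin N b.
Proof. by rewrite pbin_abs pbin_nat divr_ge0 // exprn_ge0. Qed.

Lemma pbin_large N n : (N < n)%N -> pbin N n%:Z = 0.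
Proof. by move=> Nn; rewrite pbin_nat bin_small ?mul0r //; lia. Qed.

Lemma pbin_ratio N n : (n <= N)%N ->
  (N + n).+1%:R * pbin N n.+1%:Z = (N - n)%:R * pbin N n%:Z.
Proof.
move=> nN; rewrite !pbin_nat !mulrA -!natrM addnS mul_bin_left.
by congr (_%:R / _); congr (_ * _)%N; lia.
Qed.

Lemma pbin0_rec N : (2 * N.+1)%:R * pbin N.+1 0 = (2 * N + 1)%:R * pbin N 0.
Proof.
have := @pbin_ratio N 0 (leq0n _); rewrite addn0 subn0 /= sub0r pbinN add0r => E.
have -> : pbin N 1 = N%:R / N.+1%:R * pbin N 0.
  by rewrite mulrAC -E mulrAC mulfV ?mul1r.
rewrite natrM natrD natrM -natr1; field.
by rewrite addrC natr1 pnatr_eq0.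
Qed.

Lemma pbin0_gt0 N : 0 < pbin N 0.
Proof.
by rewrite (pbin_nat N 0) divr_gt0 ?exprn_gt0 // ltr0n bin_gt0 addn0; lia.
Qed.

(** The ratio of consecutive terms is [1 - (2 i + 1) / (N + i + 1)], at most
    [exp (- (2 i + 1) / (N + n))] for [i < n]. The odd numbers add up to a square. *)
Lemma pbin_upper N n i : (0 < N + n)%N -> (i <= n)%N -> (n <= N)%N ->
  pbin N i%:Z <= expR (- (i%:R ^+ 2 / (N + n)%:R)) * pbin N 0.
Proof.
move=> Nn; elim: i => [|i IHi] iln nN.
  by rewrite expr0n /= mul0r oppr0 expR0 mul1r.
have D : 0 < (N + n)%:R :> R by rewrite ltr0n.
have D1 : 0 < (N + i).+1%:R :> R by rewrite ltr0n.
have -> : pbin N i.+1%:Z = (N - i)%:R / (N + i).+1%:R * pbin N i%:Z.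
  rewrite mulrAC -pbin_ratio; last by lia.
  by rewrite mulrAC mulfV ?mul1r // gt_eqF.
have -> : expR (- (i.+1%:R ^+ 2 / (N + n)%:R)) =
    expR (- ((2 * i + 1)%:R / (N + n)%:R)) * expR (- (i%:R ^+ 2 / (N + n)%:R)) :> R.
  rewrite -expRD; congr expR; rewrite -natr1; field.
  by rewrite -natrD gt_eqF.
rewrite -[leRHS]mulrA; apply: ler_pM; rewrite ?pbin_ge0 ?divr_ge0 //; last by apply: IHi; lia.
apply: le_trans (expR_ge1Dx _).
rewrite ler_pdivrMr // mulrDl mul1r mulNr -mulrA -lerBlDl.
rewrite -natr1 natrB; last by lia.
rewrite (_ : N%:R - i%:R - _ = - (2 * i + 1)%:R :> R); last by ring.
rewrite lerN2 ler_piMr // mulrC ler_pdivrMr // mul1r natr1 ler_nat; lia.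
Qed.

(** The inverse ratio is [1 + (2 i + 1) / (N - i)], at most [exp ((2 i + 1) / (N - n + 1))] for
    [i < n]. *)
Lemma pbin_lower N n i : (i <= n)%N -> (n <= N)%N ->
  expR (- (i%:R ^+ 2 / (N - n).+1%:R)) * pbin N 0 <= pbin N i%:Z.
Proof.
elim: i => [|i IHi] iln nN.
  by rewrite expr0n /= mul0r oppr0 expR0 mul1r.
have D : 0 < (N - n).+1%:R :> R by rewrite ltr0n.
have D1 : 0 < (N - i)%:R :> R by rewrite ltr0n subn_gt0; lia.
have D2 : 0 < (N + i).+1%:R :> R by rewrite ltr0n.
have -> : pbin N i.+1%:Z = (N - i)%:R / (N + i).+1%:R * pbin N i%:Z.
  rewrite mulrAC -pbin_ratio; last by lia.
  by rewrite mulrAC mulfV ?mul1r // gt_eqF.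
have -> : expR (- (i.+1%:R ^+ 2 / (N - n).+1%:R)) =
    expR (- ((2 * i + 1)%:R / (N - n).+1%:R)) * expR (- (i%:R ^+ 2 / (N - n).+1%:R)) :> R.
  rewrite -expRD; congr expR; rewrite -(natr1 i); field.
  by rewrite gt_eqF.
rewrite -mulrA; apply: ler_pM; rewrite ?mulr_ge0 ?expR_ge0 ?pbin_ge0 //; last by apply: IHi; lia.
rewrite expRN -[leRHS]invrK lef_pV2 ?posrE ?expR_gt0 ?invr_gt0 ?divr_gt0 //.
apply: le_trans (expR_ge1Dx _).
rewrite invf_div ler_pdivrMr // mulrDl mul1r -lerBlDl mulrAC -mulrA.
rewrite -[in leLHS]natr1 natrB; last by lia.
rewrite (_ : _ - _ = (2 * i + 1)%:R :> R); last by ring.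
rewrite ler_peMr // ler_pdivlMr // mul1r -natrB; last by lia.
by rewrite ler_nat; lia.
Qed.

Lemma subr_expRN_le (a b : R) : expR (- a) - expR (- b) <= (b - a) * expR (- a).
Proof.
have -> : - b = - a + (a - b) by ring.
rewrite expRD -{1}[expR (- a)]mulr1 -mulrBr mulrC ler_wpM2r ?expR_ge0 //.
by rewrite lerBlDr -lerBlDl; apply: le_trans (expR_ge1Dx _); rewrite opprB.
Qed.

Lemma expRN_le_inv (x : R) : 0 < x -> expR (- x) <= x^-1.
Proof.
move=> x0; rewrite expRN lef_pV2 ?posrE ?expR_gt0 //.
by apply: le_trans (expR_ge1Dx _); rewrite lerDr.
Qed.

(** For [2 n <= N], the bounds [pbin_upper] and [pbin_lower] at [i = n] have exponents within
    [O(n^3 / N^2)] of [n^2 / N], and the exponential absorbs this up to [O(1 / sqrt N)]. For larger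
    [n] both terms are tiny. *)
Lemma pbin_gauss N b : (0 < N)%N ->
  `|pbin N b - pbin N 0 * expR (- (b%:~R ^+ 2 / N%:R))|
    <= pbin N 0 * (6 / Num.sqrt N%:R).
Proof.
move=> N0; rewrite pbin_abs.
have -> : b%:~R ^+ 2 = `|b|%N%:R ^+ 2 :> R.
  by case: b => n //; rewrite NegzE mulrNz sqrrN.
move: `|b|%N => {b} n.
have Np : 0 < N%:R :> R by rewrite ltr0n.
have p0 := pbin0_gt0 N.
set s := Num.sqrt N%:R.
have s0 : 0 < s by rewrite sqrtr_gt0.
have ss : s * s = N%:R by rewrite -expr2 sqr_sqrtr ?ltW.
have s1 : 1 <= s by rewrite -[1]sqrtr1 ler_wsqrtr // ler1n.
suff [w wE wb] : exists2 w, pbin N n%:Z = w * pbin N 0 &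
    `|w - expR (- (n%:R ^+ 2 / N%:R))| <= 6 / s.
  rewrite wE [pbin N 0 * expR _]mulrC -mulrBl normrM [X in _ * X]ger0_norm; last exact: ltW.
  by rewrite mulrC ler_pM2l.
exists (pbin N n%:Z / pbin N 0); first by rewrite divfK ?gt_eqF.
set w := pbin N n%:Z / _.
have w0 : 0 <= w by rewrite divr_ge0 ?pbin_ge0.
pose t : R := n%:R ^+ 2 / N%:R; rewrite -/t.
have t0 : 0 <= t by rewrite divr_ge0 ?sqr_ge0.
have nonneg : 0 <= n%:R :> R by [].
(* Once [2 n >= N], both [n^2 / (N + n)] and [n^2 / N] are at least [N / 6]. *)
have tiny (x : R) : N%:R / 6 <= x -> expR (- x) <= 6 / s.
  move=> Nx; apply: le_trans (_ : expR (- (N%:R / 6)) <= _).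
    by rewrite ler_expR lerN2.
  apply: le_trans (expRN_le_inv _) _; first by rewrite divr_gt0.
  by rewrite invf_div ler_pM2l // lef_pV2 ?posrE // -ss ler_peMr // ltW.
have diff_le (x y : R) : 0 <= x -> 0 <= y -> x <= 6 / s -> y <= 6 / s -> `|x - y| <= 6 / s.
  by move=> *; rewrite ler_norml; apply/andP; split; lra.
have [nN|Nn] := leqP n N; last first.
  rewrite /w pbin_large // mul0r sub0r normrN ger0_norm ?expR_ge0 //.
  apply: tiny; rewrite /t ler_pdivlMr //.
  have : N%:R <= n%:R :> R by rewrite ler_nat ltnW.
  by nra.
have Nn0 : (0 < N + n)%N by rewrite addn_gt0 N0.
have Nnp : 0 < (N + n)%:R :> R by rewrite ltr0n.
have up : w <= expR (- (n%:R ^+ 2 / (N + n)%:R)).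
  by rewrite ler_pdivrMr // pbin_upper.
have [Nn2|nN2] := ltnP N (2 * n).
  have h1 : N%:R <= 2 * n%:R :> R by rewrite -natrM ler_nat ltnW.
  have h2 : n%:R <= N%:R :> R by rewrite ler_nat.
  apply: diff_le => //; rewrite ?expR_ge0 //.
    apply: le_trans up _; apply: tiny; rewrite ler_pdivlMr // natrD.
    by nra.
  by apply: tiny; rewrite /t ler_pdivlMr //; nra.
have h1 : 2 * n%:R <= N%:R :> R by rewrite -natrM ler_nat.
have D : 0 < (N - n).+1%:R :> R by rewrite ltr0n.
have lo : expR (- (n%:R ^+ 2 / (N - n).+1%:R)) <= w.
  by rewrite ler_pdivlMr // pbin_lower.
(* [n^3 / N^2 = t * (n / sqrt N) / sqrt N] and [n / sqrt N <= (1 + t) / 2] *)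
have cube : n%:R ^+ 3 / N%:R ^+ 2 <= t * (1 + t) / 2 / s.
  have -> : n%:R ^+ 3 / N%:R ^+ 2 = t * (n%:R / s) / s.
    rewrite /t -ss; field.
    by rewrite gt_eqF.
  rewrite ler_pM2r ?invr_gt0 // -mulrA ler_wpM2l //.
  have -> : t = (n%:R / s) ^+ 2 by rewrite /t expr_div_n [s ^+ 2]expr2 ss.
  by have := sqr_ge0 (n%:R / s - 1); lra.
(* The rate 2/3 is what the upper bound leaves: [N + n <= 3 N / 2] gives [n^2 / (N + n) >= 2 t / 3].
   The inequality follows from [exp x >= 1 + x^2 / 2]. *)
have quad : t * (1 + t) <= 6 * expR (2 * t / 3).
  have /= := @expR_ge1Dxn R (2 * t / 3) 1; rewrite !factS fact0.
  move=> /(_ ltac:(lra)) h; have := sqr_ge0 (t - 3 / 2).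
  rewrite (_ : 1 + (2 * t / 3) ^+ 2 / (2 * (1 * 1))%N%:R = 1 + 2 * t ^+ 2 / 9) in h; last by field.
  by move: h; rewrite !expr2; lra.
rewrite ler_norml; apply/andP; split.
  rewrite lerNl opprB; apply: le_trans (_ : expR (- t) - expR (- (n%:R ^+ 2 / (N - n).+1%:R)) <= _).
    by rewrite lerB.
  apply: le_trans (subr_expRN_le _ _) _.
  have dd : n%:R ^+ 2 / (N - n).+1%:R - t <= 2 * (n%:R ^+ 3 / N%:R ^+ 2).
    have -> : n%:R ^+ 2 / (N - n).+1%:R - t =
        n%:R ^+ 2 / N%:R * ((n%:R - 1) / (N - n).+1%:R).
      rewrite /t -natr1 natrB //; field.
      by rewrite -natrB // natr1 !gt_eqF.
    have -> : 2 * (n%:R ^+ 3 / N%:R ^+ 2) = n%:R ^+ 2 / N%:R * (2 * n%:R / N%:R) :> R.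
      by field; rewrite gt_eqF.
    rewrite ler_wpM2l // ler_pdivrMr // mulrAC ler_pdivlMr // -[(N - n).+1%:R]natr1 natrB //.
    by nra.
  apply: le_trans (_ : (t * (1 + t) / s) * expR (- t) <= _).
    rewrite ler_wpM2r ?expR_ge0 //; apply: le_trans dd _.
    by apply: le_trans (_ : 2 * (t * (1 + t) / 2 / s) <= _); [rewrite ler_wpM2l | lra].
  rewrite mulrAC ler_pM2r ?invr_gt0 // expRN ler_pdivrMr ?expR_gt0 //.
  by apply: le_trans quad _; rewrite ler_pM2l // ler_expR; lra.
apply: le_trans (_ : expR (- (n%:R ^+ 2 / (N + n)%:R)) - expR (- t) <= _).
  by rewrite lerB.
apply: le_trans (subr_expRN_le _ _) _.
have dd : t - n%:R ^+ 2 / (N + n)%:R <= n%:R ^+ 3 / N%:R ^+ 2.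
  have -> : t - n%:R ^+ 2 / (N + n)%:R = n%:R ^+ 2 / N%:R * (n%:R / (N + n)%:R).
    by rewrite /t natrD; field; rewrite -natrD !gt_eqF.
  have -> : n%:R ^+ 3 / N%:R ^+ 2 = n%:R ^+ 2 / N%:R * (n%:R / N%:R) :> R.
    by field; rewrite gt_eqF.
  by rewrite ler_wpM2l // ler_wpM2l // lef_pV2 ?posrE // ler_nat leq_addr.
apply: le_trans (_ : (t * (1 + t) / 2 / s) * expR (- (2 * t / 3)) <= _).
  apply: ler_pM; rewrite ?expR_ge0 //; last 2 first.
    exact: le_trans dd cube.
    rewrite ler_expR lerN2 /t natrD [leRHS]mulrC ler_pdivlMl -?natrD //.
    rewrite [leLHS](_ : _ = n%:R ^+ 2 * (2 / 3 * ((N + n)%:R / N%:R))); last by ring.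
    by rewrite ler_piMr ?sqr_ge0 // natrD mulrA ler_pdivrMr //; lra.
  rewrite subr_ge0 /t ler_wpM2l ?sqr_ge0 // lef_pV2 ?posrE // ler_nat leq_addr //.
rewrite mulrAC ler_pM2r ?invr_gt0 // expRN ler_pdivrMr ?expR_gt0 //.
by have := mulr_ge0 t0 (addr_ge0 ler01 t0); move: quad; set tt1 := t * _; lra.
Qed.

End CentralBinomial.

(** * Wallis' product *)

Section Wallis.
Variable R : realType.

(** The primitive of [cos^n] vanishing at 0, given by the reduction formula from integration by
    parts. Wallis' integrals are then plain values of it. *)
Fixpoint cos_pow_primitive (n : nat) (x : R) : R :=
  match n with
  | 0 => x
  | n1.+1 => match n1 with
     | 0 => sin x
     | n2.+1 => n%:R^-1 * (sin x * cos x ^+ n1 + n1%:R * cos_pow_primitive n2 x)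
     end
  end.

Lemma is_derive_cos_pow_primitive n (x : R) :
  is_derive x 1 (cos_pow_primitive n) (cos x ^+ n).
Proof.
suff [] : is_derive x 1 (cos_pow_primitive n) (cos x ^+ n) /\
  is_derive x 1 (cos_pow_primitive n.+1) (cos x ^+ n.+1) by [].
elim: n => [|n [IH1 IH2]].
  split; first by rewrite expr0; exact: is_derive_id.
  by rewrite expr1; exact: is_derive_sin.
split=> //.
have -> : cos_pow_primitive n.+2 = n.+2%:R^-1 *: (sin * cos ^+ n.+1 + n.+1%:R *: cos_pow_primitive n).
  by apply/funext => y; rewrite !fctE.
apply: is_derive_eq.
rewrite /GRing.scale /=.
have := cos2Dsin2 x; set s := sin x; set c := cos x => cs.
rewrite !fctE -/c; set E := c ^+ n.
have -> : s * (n.+1%:R * E * - s) = - (n.+1%:R * E * (1 - c ^+ 2)) by rewrite -cs; ring.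
rewrite !exprSr -/E; field.
by rewrite -natrD pnatr_eq0.
Qed.

Definition wallis n : R := cos_pow_primitive n (pi / 2).

Lemma cos_pow_primitive0 n : cos_pow_primitive n 0 = 0.
Proof.
suff [] : cos_pow_primitive n 0 = 0 /\ cos_pow_primitive n.+1 0 = 0 by [].
elim: n => [|n [IH1 IH2]]; first by rewrite /= sin0.
by split=> //; rewrite [LHS]/= sin0 IH1 mul0r mulr0 addr0 mulr0.
Qed.

Lemma wallisSS n : wallis n.+2 = n.+1%:R / n.+2%:R * wallis n.
Proof.
by rewrite /wallis [LHS]/= cos_pihalf expr0n /= mulr0 add0r mulrA [_^-1 * _]mulrC.
Qed.

Lemma wallis_prod n : n.+1%:R * wallis n * wallis n.+1 = pi / 2.
Proof.
elim: n => [|n IHn]; first by rewrite /wallis /= sin_pihalf mul1r mulr1.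
rewrite wallisSS -IHn; field.
by rewrite -natrD pnatr_eq0.
Qed.

(** The difference of the primitives has derivative [cos^n (1 - cos)], nonnegative on [[0, pi/2]],
    so the mean value theorem applies. *)
Lemma le_wallis n : wallis n.+1 <= wallis n.
Proof.
have p2 : 0 < pi / 2 :> R by rewrite divr_gt0 // pi_gt0.
pose G : R -> R := cos_pow_primitive n - cos_pow_primitive n.+1.
have dG (x : R) : is_derive x 1 G (cos x ^+ n - cos x ^+ n.+1).
  by apply: is_deriveB; exact: is_derive_cos_pow_primitive.
have [|c cI] := @MVT R G (fun x => cos x ^+ n - cos x ^+ n.+1) 0 (pi / 2) p2 (fun x _ => dG x).
  apply: derivable_within_continuous => x _.
  exact: ex_derive.
rewrite subr0 /G !fctE !cos_pow_primitive0 subr0 subr0 -subr_ge0 => ->.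
apply: mulr_ge0; last exact: ltW.
rewrite exprSr -[X in X - _]mulr1 -mulrBr mulr_ge0 //.
  rewrite exprn_ge0 // cos_ge0_pihalf //.
  by move: cI; rewrite in_itv /= => /andP[]; lra.
Qed.

Lemma wallis_pbin N : wallis (2 * N) = pi / 2 * pbin R N 0.
Proof.
elim: N => [|N IHN]; first by rewrite muln0 /wallis /= mulr1.
rewrite (_ : (2 * N.+1 = (2 * N).+2)%N); last by lia.
rewrite wallisSS IHN mulrCA; congr (_ * _).
have := pbin0_rec R N; rewrite (_ : (2 * N.+1 = (2 * N).+2)%N) ?addn1; last by lia.
move=> E; rewrite mulrAC -E mulrAC mulfV ?mul1r //.
Qed.

(** With [W = wallis], the invariant [(n + 1) W_n W_(n+1) = pi / 2] is used at [n = 2N] with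
    [W_(2N+1) <= W_(2N)] for the lower bound, and at [n = 2N - 1] with [W_(2N) <= W_(2N-1)] for the
    upper one. *)
Lemma pbin0_wallis N : (0 < N)%N ->
  (2 * N)%:R / (2 * N + 1)%:R <= pi * N%:R * pbin R N 0 ^+ 2 <= 1.
Proof.
move=> N0; have pi0 := pi_gt0 R.
have w0 n : 0 < wallis n.
  have := wallis_prod n => E; rewrite lt_neqAle; apply/andP; split.
    apply/eqP => W; move: E; rewrite -W mulr0 mul0r; lra.
  have H j : 0 <= wallis j /\ 0 <= wallis j.+1.
    elim: j => [|j [H1 H2]]; first by rewrite /wallis /= sin_pihalf; split=> //; lra.
    by split=> //; rewrite wallisSS mulr_ge0 // divr_ge0.
  exact: (H n).1.
set p := pbin R N 0.
have pE : wallis (2 * N) = pi / 2 * p by exact: wallis_pbin.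
have N0' : 0 < N%:R :> R by rewrite ltr0n.
apply/andP; split.
  have := wallis_prod (2 * N); have := le_wallis (2 * N).
  rewrite -addn1 => h E.
  have D : 0 < (2 * N + 1)%:R :> R by rewrite ltr0n addn1.
  have : pi / 2 <= (2 * N + 1)%:R * wallis (2 * N) * wallis (2 * N).
    by rewrite -[leLHS]E ler_pM2l // mulr_gt0.
  rewrite pE => h2; rewrite ler_pdivrMr // natrM.
  have {}h2 : 1 <= (2 * N + 1)%:R * (pi / 2) * p ^+ 2.
    rewrite -(@ler_pM2l _ (pi / 2)) ?divr_gt0 // mulr1.
    by apply: le_trans h2 _; rewrite le_eqVlt; apply/orP; left; apply/eqP; ring.
  have := ler_wpM2l (ltW N0') h2; nra.
have := wallis_prod (2 * N).-1; have := le_wallis (2 * N).-1.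
rewrite prednK ?muln_gt0 // => h E.
have : (2 * N)%:R * wallis (2 * N) * wallis (2 * N) <= pi / 2.
  by rewrite -[leRHS]E ler_pM2r // ler_pM2l // ltr0n muln_gt0.
rewrite pE natrM => h2.
rewrite -(@ler_pM2l _ (pi / 2)) ?divr_gt0 // mulr1.
by apply: le_trans _ h2; rewrite le_eqVlt; apply/orP; left; apply/eqP; field.
Qed.

(** The quantity [(2N + 1) pbin N 0 ^ 2] starts at 1 and does not increase, because
    [(2N + 1) (2N + 3) <= (2N + 2)^2]. *)
Lemma pbin0_le_invsqrt N : pbin R N 0 <= (Num.sqrt N.+1%:R)^-1.
Proof.
have H : pbin R N 0 ^+ 2 * (2 * N + 1)%:R <= 1.
  elim: N => [|N IHN]; first by rewrite /= expr1n mul1r.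
  have -> : pbin R N.+1 0 = (2 * N + 1)%:R / (2 * N.+1)%:R * pbin R N 0.
    by rewrite mulrAC -pbin0_rec mulrAC mulfV ?mul1r // pnatr_eq0.
  apply: le_trans IHN; rewrite exprMn mulrAC [leRHS]mulrC ler_wpM2r ?sqr_ge0 //.
  rewrite expr_div_n mulrAC ler_pdivrMr ?exprn_gt0 ?ltr0n //.
  by rewrite -!natrX -!natrM ler_nat; nia.
rewrite -[leLHS]invrK lef_pV2 ?posrE ?invr_gt0 ?sqrtr_gt0 ?ltr0n ?pbin0_gt0 //.
have p0 := pbin0_gt0 R N.
rewrite -[leRHS]ger0_norm ?invr_ge0 ?(ltW p0) // -sqrtr_sqr ler_wsqrtr // exprVn.
rewrite -[leLHS]invrK lef_pV2 ?posrE ?invr_gt0 ?exprn_gt0 // -[leRHS]div1r.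
rewrite ler_pdivlMr //; apply: le_trans H; rewrite ler_wpM2l ?sqr_ge0 // ler_nat; lia.
Qed.

End Wallis.

(** * Bounds on the character sums *)

Section Elementary.
Variable R : realType.

Lemma normr_prodB (I : Type) (r : seq I) (B : R) (a b : I -> R) : 1 <= B ->
  (forall i, `|a i| <= B) -> (forall i, `|b i| <= B) ->
  `|\prod_(i <- r) a i - \prod_(i <- r) b i| <=
    B ^+ size r * \sum_(i <- r) `|a i - b i|.
Proof.
move=> B1 aB bB; have B0 : 0 <= B by exact: le_trans ler01 B1.
have bP s : `|\prod_(i <- s) b i| <= B ^+ size s.
  elim: s => [|i s IHs]; first by rewrite big_nil normr1.
  by rewrite big_cons normrM exprS ler_pM.
elim: r => [|i r IHr]; first by rewrite !big_nil subrr normr0 mulr0.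
rewrite !big_cons /=.
set A := \prod_(j <- r) a j in IHr *; set C := \prod_(j <- r) b j in IHr *.
have -> : a i * A - b i * C = a i * (A - C) + (a i - b i) * C by ring.
apply: le_trans (ler_normD _ _) _; rewrite !normrM mulrDr addrC lerD //.
  rewrite mulrC ler_wpM2r //; apply: le_trans (bP r) _.
  by rewrite exprS ler_peMl // exprn_ge0.
by rewrite exprS -mulrA ler_pM.
Qed.

Lemma normr_exprB (B a b : R) n : `|a| <= B -> `|b| <= B ->
  `|a ^+ n.+1 - b ^+ n.+1| <= n.+1%:R * `|a - b| * B ^+ n.
Proof.
move=> aB bB; have B0 : 0 <= B by apply: le_trans aB.
elim: n => [|n IHn]; first by rewrite !expr1 expr0 mulr1 mul1r.
have -> : a ^+ n.+2 - b ^+ n.+2 = a * (a ^+ n.+1 - b ^+ n.+1) + (a - b) * b ^+ n.+1.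
  by rewrite !(exprS _ n.+1); ring.
apply: le_trans (ler_normD _ _) _; rewrite !normrM -natr1 mulrDl mul1r mulrDl.
apply: lerD; last by rewrite ler_wpM2l // normrX lerXn2r ?nnegrE.
by rewrite [B ^+ _]exprSr mulrA mulrC ler_pM.
Qed.

Lemma expRN_taylor1 (x : R) : 0 <= x -> `|expR (- x) - (1 - x)| <= x ^+ 2.
Proof.
move=> x0; rewrite ger0_norm ?subr_ge0 ?expR_ge1Dx //.
have h : 1 + x <= expR x by exact: expR_ge1Dx.
have : expR (- x) <= (1 + x)^-1 by rewrite expRN lef_pV2 ?posrE ?expR_gt0 //; lra.
suff : (1 + x)^-1 <= 1 - x + x ^+ 2 by lra.
rewrite -[leLHS]mul1r ler_pdivrMr; last by lra.
by have := exprn_ge0 3 x0; rewrite !exprS expr0; lra.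
Qed.

(** Used to trade a polynomial factor for part of an exponential. With [x = a t / 2],
    [exp (a t) >= (1 + x)^2] reduces the claim to a comparison of quadratics. *)
Lemma mul_expRN_le (a t : R) : 0 < a -> 0 <= t ->
  (t ^+ 2 + t) * expR (- (a * t)) <= 8 / a ^+ 2 + 2 / a.
Proof.
move=> a0 t0; pose x := a * t / 2.
have x0 : 0 <= x by rewrite /x divr_ge0 ?mulr_ge0 // ltW.
have h1 : 1 + x <= expR x by exact: expR_ge1Dx.
have h2 : (1 + x) ^+ 2 <= expR x ^+ 2 by rewrite lerXn2r ?nnegrE ?expR_ge0 //; lra.
have E : expR (a * t) = expR x ^+ 2.
  by rewrite expr2 -expRD; congr expR; rewrite /x; field.
rewrite expRN E ler_pdivrMr ?exprn_gt0 ?expR_gt0 //.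
apply: le_trans (_ : (8 / a ^+ 2 + 2 / a) * (1 + x) ^+ 2 <= _); last first.
  by rewrite ler_wpM2l // addr_ge0 // divr_ge0 // ?exprn_ge0 // ltW.
have -> : t = 2 * x / a by rewrite /x; field; rewrite gt_eqF.
rewrite -(ler_pM2r (exprn_gt0 2 a0)).
have -> : ((2 * x / a) ^+ 2 + 2 * x / a) * a ^+ 2 = 4 * x ^+ 2 + 2 * x * a.
  by field; rewrite gt_eqF.
have -> : (8 / a ^+ 2 + 2 / a) * (1 + x) ^+ 2 * a ^+ 2 = (8 + 2 * a) * (1 + x) ^+ 2.
  by field; rewrite gt_eqF.
have := mulr_ge0 (ltW a0) x0; have := mulr_ge0 (ltW a0) (sqr_ge0 x).
by rewrite expr2 => *; have := sqr_ge0 x; nra.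
Qed.

Lemma dickson_roots (q l mu y : R) m : l + mu = y -> l * mu = q ->
  dickson q y m = l ^+ m + mu ^+ m.
Proof.
move=> <- <-.
suff [] : dickson (l * mu) (l + mu) m = l ^+ m + mu ^+ m /\
  dickson (l * mu) (l + mu) m.+1 = l ^+ m.+1 + mu ^+ m.+1 by [].
elim: m => [|m [IH1 IH2]]; first by rewrite /= !expr0 !expr1; split.
by split=> //; rewrite dicksonSS IH1 IH2 !exprS; ring.
Qed.

(** The case of conjugate roots [s e^(i x)] and [s e^(- i x)], stated without complex numbers. *)
Lemma dickson_cos (s x : R) m :
  dickson (s ^+ 2) (2 * s * cos x) m = 2 * s ^+ m * cos (m%:R * x).
Proof.
suff [] : dickson (s ^+ 2) (2 * s * cos x) m = 2 * s ^+ m * cos (m%:R * x) /\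
  dickson (s ^+ 2) (2 * s * cos x) m.+1 = 2 * s ^+ m.+1 * cos (m.+1%:R * x) by [].
elim: m => [|m [IH1 IH2]]; first by rewrite /= mul0r cos0 mul1r expr0 !mulr1.
split=> //; rewrite dicksonSS IH1 IH2.
have -> : m.+2%:R * x = m.+1%:R * x + x by rewrite -[m.+2%:R]natr1; ring.
have -> : m%:R * x = m.+1%:R * x - x by rewrite -[m.+1%:R]natr1; ring.
by rewrite cosB cosD !exprS; ring.
Qed.

Lemma dicksonN (q y : R) m : dickson q (- y) m = (-1) ^+ m * dickson q y m.
Proof.
suff [] : dickson q (- y) m = (-1) ^+ m * dickson q y m /\
  dickson q (- y) m.+1 = (-1) ^+ m.+1 * dickson q y m.+1 by [].
elim: m => [|m [IH1 IH2]]; first by rewrite /= expr0 expr1 mul1r mulN1r.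
by split=> //; rewrite !dicksonSS IH1 IH2 !exprS; ring.
Qed.

End Elementary.

(** * Comparison of the character sums with the binomial transform *)

Section SpectralBound.
Variables (k : nat) (R : realType).
Hypothesis hk : (2 <= k)%N.
Implicit Types (u : 'I_k -> R).

Let q : R := 2 * k%:R - 1.
Let kap : R := k%:R - 1.

Lemma kap_ge1 : 1 <= kap.
Proof. by have : 2 <= k%:R :> R by [rewrite ler_nat]; rewrite /kap; lra. Qed.

Lemma q_kap : q = 2 * kap + 1.
Proof. by rewrite /q /kap; ring. Qed.

(* The variance of [pbin] after [steps m] steps is [m / (k - 1)] up to [O(1)]. *)
Definition steps (m : nat) : nat := (2 * m) %/ k.-1.

Lemma steps_bounds m : (steps m)%:R * kap <= 2 * m%:R < ((steps m)%:R + 1) * kap.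
Proof.
have k1 : (0 < k.-1)%N by lia.
have -> : kap = k.-1%:R by rewrite /kap -[in LHS](prednK (ltnW hk)) -natr1 addrK.
rewrite natr1 -!natrM ler_nat ltr_nat leq_divM /=.
exact: ltn_ceil.
Qed.

Definition half_box u := (forall j, 0 <= u j <= 2) /\ \sum_j u j <= k%:R.

(** The class of admissible errors. The exponential has grid average [O(m^(-k/2))], the order of the
    main term, so [1 / m] is the gain. *)
Definition decays (F : nat -> ('I_k -> R) -> R) :=
  exists C c : R, [/\ 0 <= C, 0 < c & forall m u, (0 < m)%N -> half_box u ->
    `|F m u| <= C / m%:R * expR (- (c * m%:R * \sum_j u j))].

Lemma half_box_ge0 u : half_box u -> 0 <= \sum_j u j.
Proof. by case=> u02 _; apply: sumr_ge0 => j _; case/andP: (u02 j). Qed.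

Lemma decaysD F G H : decays F -> decays G ->
  (forall m u, (0 < m)%N -> half_box u -> `|H m u| <= `|F m u| + `|G m u|) ->
  decays H.
Proof.
case=> [C [c [C0 c0 hF]]] [D [d [D0 d0 hG]]] HFG.
exists (C + D), (Num.min c d); split; rewrite ?addr_ge0 ?lt_min ?c0 //.
move=> m u m0 du; apply: le_trans (HFG _ _ m0 du) _.
rewrite !mulrDl lerD //.
  apply: le_trans (hF _ _ m0 du) _; rewrite ler_wpM2l ?divr_ge0 // ler_expR lerN2.
  by rewrite -!mulrA ler_wpM2r ?mulr_ge0 ?half_box_ge0 // ge_min lexx.
apply: le_trans (hG _ _ m0 du) _; rewrite ler_wpM2l ?divr_ge0 // ler_expR lerN2.
by rewrite -!mulrA ler_wpM2r ?mulr_ge0 ?half_box_ge0 // ge_min lexx orbT.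
Qed.

(** Here [m s^2 + s = ((m s)^2 + m s) / m], and half of the exponential absorbs the polynomial in
    [m s]. *)
Lemma decays_sq F A a : 0 <= A -> 0 < a ->
  (forall m u s, (0 < m)%N -> half_box u -> s = \sum_j u j ->
    `|F m u| <= A * (m%:R * s ^+ 2 + s) * expR (- (a * m%:R * s))) -> decays F.
Proof.
move=> A0 a0 hF; have a2 : 0 < a / 2 by rewrite divr_gt0.
exists (A * (8 / (a / 2) ^+ 2 + 2 / (a / 2))), (a / 2); split => //.
  by rewrite mulr_ge0 // addr_ge0 // divr_ge0 // ?exprn_ge0 // ltW.
move=> m u m0 du; apply: le_trans (hF _ _ _ m0 du erefl) _; set s := \sum_j u j.
have s0 : 0 <= s by exact: half_box_ge0.
have mp : 0 < m%:R :> R by rewrite ltr0n.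
have t0 : 0 <= m%:R * s by rewrite mulr_ge0.
have h := mul_expRN_le a2 t0.
have -> : m%:R * s ^+ 2 + s = ((m%:R * s) ^+ 2 + m%:R * s) / m%:R.
  by field; rewrite gt_eqF.
have -> : expR (- (a * m%:R * s)) = expR (- (a / 2 * (m%:R * s))) * expR (- (a / 2 * m%:R * s)).
  by rewrite -expRD; congr expR; field.
rewrite mulrA ler_wpM2r ?expR_ge0 // -!mulrA ler_wpM2l //.
rewrite mulrCA mulrC ler_wpM2r ?invr_ge0 //; apply: le_trans h.
by rewrite -!mulrA.
Qed.

(** Half of the decay in [m] yields [1 / m]; the other half is at most [exp (- c m s)] with
    [c = a / (2 k)], because [s <= k]. *)
Lemma decays_exp F A a : 0 <= A -> 0 < a ->
  (forall m u, (0 < m)%N -> half_box u -> `|F m u| <= A * expR (- (a * m%:R))) ->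
  decays F.
Proof.
move=> A0 a0 hF; have kp : 0 < k%:R :> R by rewrite ltr0n; lia.
exists (A * (2 / a)), (a / 2 / k%:R); split; rewrite ?mulr_ge0 ?divr_gt0 //.
  by rewrite invr_ge0 ltW.
move=> m u m0 du; apply: le_trans (hF _ _ m0 du) _; set s := \sum_j u j.
have mp : 0 < m%:R :> R by rewrite ltr0n.
have x0 : 0 < a / 2 * m%:R by rewrite mulr_gt0 // divr_gt0.
have -> : a * m%:R = a / 2 * m%:R + a / 2 * m%:R by field.
rewrite opprD expRD mulrA; apply: ler_pM; rewrite ?mulr_ge0 ?expR_ge0 //.
  rewrite -[leRHS]mulrA ler_wpM2l //; apply: le_trans (expRN_le_inv x0) _.
  by rewrite invfM invf_div.
rewrite ler_expR lerN2 (_ : _ * s = a / 2 * m%:R * (s / k%:R)); last by ring.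
by rewrite ler_piMr ?(ltW x0) // ler_pdivrMr // mul1r; case: du.
Qed.

(** The transform of the product binomial law in the variables [u j = 1 - cos x_j]; [sin_prod] is
    the same after [x -> x + pi]. *)
Definition cos_prod (m : nat) u : R := \prod_j (1 - u j / 2) ^+ steps m.
Definition sin_prod (m : nat) u : R := \prod_j (u j / 2) ^+ steps m.

(** The product [Q] of the [1 - u j / 2] lies below [E = exp (- s / 2)] and within [s^2] of it, so
    the [n]-th powers differ by at most [n s^2 E^(n-1)]. Replacing [n / 2] by [m / (k - 1)] changes
    the exponent by at most [s / 2]. Both errors have the shape required by [decays_sq]. *)
Lemma decays_cos_prod :
  decays (fun m u => cos_prod m u - expR (- (m%:R * (\sum_j u j) / kap))).
Proof.
have k1 := kap_ge1; have kp : 0 < kap by lra.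
apply: (@decays_sq _ (2 * expR k%:R) kap^-1); rewrite ?mulr_ge0 ?expR_ge0 ?invr_gt0 //.
move=> m u _ m0 du ->; have [u02 sk] := du; set s := \sum_j u j.
have s0 : 0 <= s by exact: half_box_ge0.
have mp : 0 < m%:R :> R by rewrite ltr0n.
have /andP[n1 n2] := steps_bounds m; rewrite /cos_prod prodrXl.
move: (steps m) n1 n2 => n n1 n2.
set E := expR (- (s / 2)); set Q := \prod_j (1 - u j / 2).
have cE : expR (- (m%:R * s / kap)) = expR (- (kap^-1 * m%:R * s)).
  by congr (expR (- _)); rewrite mulrC mulrA.
rewrite cE; set e := expR _.
have EQ : `|Q - E| <= s ^+ 2.
  have -> : E = \prod_j expR (- (u j / 2)).
    by rewrite -expR_sum /E; congr expR; rewrite /s mulr_suml sumrN.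
  have h1 j : `|1 - u j / 2| <= 1.
    by rewrite ler_norml; have /andP[] := u02 j => *; apply/andP; split; lra.
  have h2 j : `|expR (- (u j / 2))| <= 1.
    by rewrite ger0_norm ?expR_ge0 // expR_le1 oppr_le0 divr_ge0 //; case/andP: (u02 j).
  apply: le_trans (normr_prodB _ (lexx 1) h1 h2) _; rewrite expr1n mul1r.
  apply: le_trans (_ : \sum_j u j * s <= _); last by rewrite -mulr_suml -expr2.
  apply: ler_sum => j _; have /andP[uj0 _] := u02 j; rewrite distrC.
  apply: le_trans (expRN_taylor1 _) _; first by rewrite divr_ge0.
  have : u j <= s.
    by rewrite /s (bigD1 j) //= lerDl sumr_ge0 // => i _; case/andP: (u02 i).
  by nra.
have hs : s <= k%:R by [].
pose w := kap^-1 * m%:R.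
have nw : n%:R <= 2 * w by rewrite /w mulrCA mulrC ler_pdivlMr.
have wn : 2 * w <= n%:R + 1 by rewrite /w mulrCA mulrC ler_pdivrMr // ltW.
have wm : w <= m%:R by rewrite /w ler_piMl // invf_le1.
(* A loss of at most [s] in the exponent costs a factor [exp k], since [s <= k]. *)
have eE x : w * s - s <= x -> expR (- x) <= expR k%:R * e.
  by rewrite /e -expRD ler_expR -/w => h; lra.
have En j : E ^+ j = expR (- (j%:R * (s / 2))) by rewrite -expRM_natl mulrN.
have E0 : 0 <= E by exact: expR_ge0.
have Q0 : 0 <= Q.
  by apply: prodr_ge0 => j _; have /andP[] := u02 j; lra.
have QE : Q <= E.
  have -> : E = \prod_j expR (- (u j / 2)).
    by rewrite -expR_sum /E; congr expR; rewrite /s mulr_suml sumrN.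
  apply: ler_prod => j _; have /andP[_ uj2] := u02 j.
  by rewrite expR_ge1Dx andbT; lra.
have e0 : 0 <= expR k%:R * e by rewrite mulr_ge0 ?expR_ge0.
have P1 : `|Q ^+ n - E ^+ n| <= 2 * m%:R * s ^+ 2 * (expR k%:R * e).
  case: n n1 n2 nw wn => [|n] n1 n2 nw wn.
    by rewrite !expr0 subrr normr0 mulr_ge0 // mulr_ge0 ?sqr_ge0 // mulr_ge0.
  apply: le_trans (@normr_exprB R E Q E n _ _) _; rewrite ?(ger0_norm E0) ?(ger0_norm Q0) //.
  apply: ler_pM; rewrite ?exprn_ge0 ?mulr_ge0 //.
    by apply: ler_pM => //; apply: le_trans nw _; lra.
  rewrite En; apply: eE; rewrite -[n.+1%:R]natr1 in wn.
  have := mulr_ge0 s0 (_ : 0 <= n%:R + 1 + 1 - 2 * w); rewrite subr_ge0 => /(_ wn).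
  by lra.
have P2 : `|E ^+ n - e| <= s * (expR k%:R * e).
  have d0 : 0 <= s * (2 * w - n%:R) by rewrite mulr_ge0 // subr_ge0.
  have d1 : 0 <= s * (n%:R + 1 - 2 * w) by rewrite mulr_ge0 // subr_ge0.
  rewrite ger0_norm; last first.
    by rewrite subr_ge0 En ler_expR lerN2 -/w; lra.
  rewrite En; apply: le_trans (subr_expRN_le _ _) _.
  rewrite -/w; apply: ler_pM; rewrite ?expR_ge0 //; try lra.
  by apply: eE; lra.
have -> : Q ^+ n - e = (Q ^+ n - E ^+ n) + (E ^+ n - e) by ring.
apply: le_trans (ler_normD _ _) _; apply: le_trans (lerD P1 P2) _.
by rewrite -mulrDl -[leRHS]mulrA [2 * _ * _]mulrC -!mulrA; nra.
Qed.

(** From [u / 2 <= exp (- (1 - u / 2))] the base is at most [exp (- k / 2)] on the half box, so the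
    power is exponentially small in [m]. *)
Lemma decays_sin_prod : decays (fun m u => sin_prod m u).
Proof.
have k1 := kap_ge1; have kp : 0 < kap by lra.
have kR : k%:R = kap + 1 by rewrite /kap; ring.
apply: (@decays_exp _ (expR k%:R) 1); rewrite ?expR_ge0 //.
move=> m u m0 [u02 sk]; have /andP[_ n2] := steps_bounds m; rewrite /sin_prod prodrXl.
move: (steps m) n2 => n n2; set Q := \prod_j _.
have Q0 : 0 <= Q by apply: prodr_ge0 => j _; have /andP[] := u02 j; lra.
have QE : Q <= expR (- (k%:R / 2)).
  apply: le_trans (_ : \prod_j expR (- (1 - u j / 2)) <= _).
    apply: ler_prod => j _; have /andP[uj0 _] := u02 j.
    by apply/andP; split; [lra|apply: le_trans (expR_ge1Dx _); lra].
  rewrite -expR_sum ler_expR sumrN lerN2 sumrB -mulr_suml sumr_const card_ord.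
  by lra.
rewrite ger0_norm ?exprn_ge0 // mul1r -expRD.
apply: le_trans (_ : expR (- (k%:R / 2)) ^+ n <= _).
  by rewrite lerXn2r ?nnegrE ?expR_ge0.
rewrite -expRM_natl ler_expR kR.
have : 0 <= n%:R :> R by [].
by nra.
Qed.

(* Near the top of the spectrum: the larger root [k - s + r] of
   [X^2 - 2 (k - s) X + q], divided by [q], is [1 - s / (k - 1) + O(s^2)]. *)
Lemma top_root_bounds (s r : R) : 0 <= s -> s <= k%:R -> 0 <= r ->
  r ^+ 2 = (k%:R - s) ^+ 2 - q ->
  (k%:R - s + r) / q <= 1 - s / (2 * kap) /\
  `|(k%:R - s + r) / q - (1 - s / kap)| <= 3 * k%:R ^+ 2 * s ^+ 2.
Proof.
have k1 := kap_ge1; have kp : 0 < kap by lra.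
have kR : k%:R = kap + 1 by rewrite /kap; ring.
have qk := q_kap; have qp : 0 < q by lra.
move=> s0 sk r0 rE.
pose w := 2 * k%:R * s - s ^+ 2.
have rw : r ^+ 2 = kap ^+ 2 - w by rewrite rE /w qk kR; ring.
have w0 : 0 <= w by rewrite /w; nra.
pose t := w / kap ^+ 2.
have tw : w = t * kap ^+ 2 by rewrite /t divfK // expf_neq0 // gt_eqF.
have t0 : 0 <= t by rewrite /t divr_ge0 // exprn_ge0 // ltW.
have t1 : t <= 1.
  by rewrite /t ler_pdivrMr ?exprn_gt0 // mul1r; have := sqr_ge0 r; lra.
(* As [r = kap sqrt (1 - t)], the two bounds on [r] are [1 - t/2 - t^2/2 <= sqrt (1 - t) <= 1 - t/2]
   on [[0, 1]], checked by squaring. *)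
have rup : r <= kap * (1 - t / 2).
  have h : 0 <= kap * (1 - t / 2) by rewrite mulr_ge0 ?ltW //; lra.
  rewrite -(@ler_sqr _ r) ?nnegrE // rw tw exprMn.
  have := mulr_ge0 (sqr_ge0 kap) (sqr_ge0 t); set T := kap ^+ 2.
  by rewrite (_ : (1 - t / 2) ^+ 2 = 1 - t + t ^+ 2 / 4); [lra | field].
have rlo : kap * (1 - t / 2 - t ^+ 2 / 2) <= r.
  have h : 0 <= 1 - t / 2 - t ^+ 2 / 2 by nra.
  rewrite -(@ler_sqr _ _ r) ?nnegrE ?mulr_ge0 ?(ltW kp) // rw tw exprMn.
  have -> : kap ^+ 2 - t * kap ^+ 2 = kap ^+ 2 * (1 - t) by ring.
  rewrite ler_wpM2l ?sqr_ge0 //.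
  have -> : (1 - t / 2 - t ^+ 2 / 2) ^+ 2 =
     (1 - t) * (1 - t ^+ 2 * (3 / 4 + t / 4)) by field.
  rewrite ler_piMr ?subr_ge0 // gerBl mulr_ge0 ?sqr_ge0 //; lra.
have kt : kap * (t / 2) = k%:R * s / kap - s ^+ 2 / (2 * kap).
  by rewrite /t /w; field; rewrite gt_eqF.
have up : (k%:R - s + r) / q <= 1 - s / kap + s ^+ 2 / (2 * kap * q).
  have -> : 1 - s / kap + s ^+ 2 / (2 * kap * q) =
      (k%:R - s + kap * (1 - t / 2)) / q.
    rewrite [kap * (1 - _)]mulrBr mulr1 kt kR qk; field.
    by rewrite -qk !gt_eqF.
  by rewrite ler_pM2r ?invr_gt0 // lerD2l.
have lo : 1 - s / kap + s ^+ 2 / (2 * kap * q) - kap * t ^+ 2 / (2 * q) <= (k%:R - s + r) / q.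
  have -> : 1 - s / kap + s ^+ 2 / (2 * kap * q) - kap * t ^+ 2 / (2 * q) =
      (k%:R - s + kap * (1 - t / 2 - t ^+ 2 / 2)) / q.
    rewrite (_ : kap * (1 - t / 2 - t ^+ 2 / 2) = kap - kap * (t / 2) - kap * t ^+ 2 / 2).
      by rewrite kt kR qk; field; rewrite -qk !gt_eqF.
    by ring.
  by rewrite ler_pM2r ?invr_gt0 // lerD2l.
have s2 : 0 <= s ^+ 2 by exact: sqr_ge0.
split.
  apply: le_trans up _; rewrite -subr_ge0.
  have -> : 1 - s / (2 * kap) - (1 - s / kap + s ^+ 2 / (2 * kap * q)) =
     s * (q - s) / (2 * kap * q) by field; rewrite !gt_eqF.
  by rewrite divr_ge0 ?mulr_ge0 //; lra.
have a1 : 0 <= s ^+ 2 / (2 * kap * q) <= s ^+ 2.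
  rewrite divr_ge0 ?mulr_ge0 ?(ltW kp) ?(ltW qp) //= ler_pdivrMr ?mulr_gt0 //.
  by rewrite ler_peMr //; nra.
have a2 : 0 <= kap * t ^+ 2 / (2 * q).
  by apply: divr_ge0; apply: mulr_ge0; rewrite ?sqr_ge0 ?(ltW kp) ?(ltW qp).
have a2' : kap * t ^+ 2 / (2 * q) <= 2 * k%:R ^+ 2 * s ^+ 2.
  have tk : t <= 2 * k%:R * s / kap.
    rewrite /t ler_pdivrMr ?exprn_gt0 //.
    have -> : 2 * k%:R * s / kap * kap ^+ 2 = 2 * k%:R * s * kap by field; rewrite gt_eqF.
    have : 0 <= 2 * k%:R * s by rewrite !mulr_ge0.
    by rewrite /w; nra.
  have t2 : t ^+ 2 <= (2 * k%:R * s / kap) ^+ 2.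
    by rewrite ler_sqr ?nnegrE // divr_ge0 ?mulr_ge0 // ltW.
  apply: le_trans (_ : kap * (2 * k%:R * s / kap) ^+ 2 / (2 * q) <= _).
    by rewrite ler_pM2r ?invr_gt0 ?mulr_gt0 // ler_pM2l.
  have -> : kap * (2 * k%:R * s / kap) ^+ 2 / (2 * q) =
      2 * k%:R ^+ 2 * s ^+ 2 / (kap * q) by field; rewrite !gt_eqF.
  rewrite ler_pdivrMr ?mulr_gt0 // ler_peMr //; last by nra.
  by rewrite !mulr_ge0 ?sqr_ge0.
have k2 : 1 <= k%:R ^+ 2 :> R by rewrite exprn_ege1 // ler1n ltnW.
have a3 : s ^+ 2 <= k%:R ^+ 2 * s ^+ 2 by rewrite ler_peMl.
case/andP: a1 => a1 a1'.
by rewrite ler_norml; apply/andP; split; lra.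
Qed.

(** For real roots, the larger one is controlled by [top_root_bounds] and the smaller one is at most
    [sqrt q]. For conjugate roots both have modulus [sqrt q], and [s] is bounded away from 0, so
    every term is exponentially small in [m]. *)
Lemma decays_dickson : decays (fun m u =>
  dickson q (2 * (k%:R - \sum_j u j)) m / q ^+ m - expR (- (m%:R * (\sum_j u j) / kap))).
Proof.
have k1 := kap_ge1; have kp : 0 < kap by lra.
have kR : k%:R = kap + 1 by rewrite /kap; ring.
have qk := q_kap; have qp : 0 < q by lra.
pose sq := Num.sqrt q.
have sq2 : sq ^+ 2 = q by rewrite sqr_sqrtr // ltW.
have sq1 : 1 < sq by rewrite -[1]sqrtr1 ltr_sqrt; lra.
have sqp : 0 < sq by lra.
have sqk : sq < k%:R.
  rewrite -(ltr_pXn2r (_ : 0 < 2)%N) ?nnegrE ?(ltW sqp) // sq2 qk kR.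
  by have := exprn_gt0 2 kp; lra.
pose s0 := (k%:R - sq) / kap.
have s0p : 0 < s0 by rewrite divr_gt0 // subr_gt0.
have lp : 0 < ln sq by rewrite ln_gt0.
(* [ln sq] is the decay rate of [(sqrt q / q)^m]; [s0] is that of [exp (- m s / (k - 1))] once
   [s > k - sqrt q]. *)
pose al := Num.min (ln sq) s0.
have alp : 0 < al by rewrite lt_min lp.
have k2e : 0 <= 4 * k%:R ^+ 2 * expR k%:R :> R by rewrite !mulr_ge0 ?expR_ge0 ?exprn_ge0.
have ka2 : 0 < (2 * kap)^-1 by rewrite invr_gt0 mulr_gt0.
pose A1 m u : R := 4 * k%:R ^+ 2 * expR k%:R * (m%:R * (\sum_j u j) ^+ 2 + \sum_j u j)
  * expR (- ((2 * kap)^-1 * m%:R * \sum_j u j)).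
have dA1 : decays A1.
  apply: (@decays_sq _ _ _ k2e ka2) => m u s m0 du ->.
  rewrite ger0_norm // mulr_ge0 ?expR_ge0 // mulr_ge0 // addr_ge0 ?half_box_ge0 //.
  by rewrite mulr_ge0 ?sqr_ge0.
have dA2 : decays (fun m _ => 3 * expR (- (al * m%:R))).
  by apply: (@decays_exp _ 3 al) => // m u _ _; rewrite ger0_norm // mulr_ge0 ?expR_ge0.
apply: (decaysD dA1 dA2) => m u m0 du.
rewrite [X in _ <= _ + X]ger0_norm; last by rewrite mulr_ge0 ?expR_ge0.
rewrite /A1; have [u02 sk] := du; have s0' := half_box_ge0 du.
move: (\sum_j u j) sk s0' => s sk s0'.
have sqm : (sq / q) ^+ m <= expR (- (al * m%:R)).
  have -> : sq / q = expR (- ln sq).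
    by rewrite expRN lnK ?posrE // -sq2; field; rewrite gt_eqF.
  rewrite -expRM_natl ler_expR mulrN lerN2 mulrC.
  by rewrite ler_wpM2l // ge_min lexx.
have em0 : 0 <= expR (- (al * m%:R)) by exact: expR_ge0.
have sqq : 0 <= sq / q by rewrite divr_ge0 ?ltW.
(* The discriminant changes sign at [k - s = sqrt q]. Real roots come first. *)
have [cs|sc] := ltP (k%:R - s) sq; last first.
  have r2 : 0 <= (k%:R - s) ^+ 2 - q.
    by rewrite subr_ge0 -sq2 ler_sqr ?nnegrE ?(ltW sqp) //; lra.
  pose r := Num.sqrt ((k%:R - s) ^+ 2 - q).
  have rE : r ^+ 2 = (k%:R - s) ^+ 2 - q by rewrite sqr_sqrtr.
  have r0 : 0 <= r by exact: sqrtr_ge0.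
  have [b1 b2] := top_root_bounds s0' sk r0 rE.
  have lm : (k%:R - s + r) * (k%:R - s - r) = q.
    have -> : (k%:R - s + r) * (k%:R - s - r) = (k%:R - s) ^+ 2 - r ^+ 2 by ring.
    by rewrite rE; ring.
  rewrite (@dickson_roots R q (k%:R - s + r) (k%:R - s - r)); [|by ring|exact: lm].
  rewrite mulrDl -!expr_div_n.
  set a := (_ + r) / q in b1 b2 *; set mu := (_ - r) / q.
  have mu0 : 0 <= k%:R - s - r.
    rewrite subr_ge0 -(@ler_sqr _ r) ?nnegrE ?rE //; lra.
  have mu1 : `|mu ^+ m| <= expR (- (al * m%:R)).
    rewrite ger0_norm ?exprn_ge0 ?divr_ge0 ?(ltW qp) //; apply: le_trans sqm.
    apply: lerXn2r; rewrite ?nnegrE ?divr_ge0 ?(ltW qp) ?(ltW sqp) // ler_pM2r ?invr_gt0 //.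
    rewrite -(@ler_sqr _ _ sq) ?nnegrE ?(ltW sqp) // sq2 -[leRHS]lm expr2 ler_wpM2r //.
    by lra.
  pose b := expR (- (s / kap)); pose B := expR (- (s / (2 * kap))).
  have -> : expR (- (m%:R * s / kap)) = b ^+ m.
    by rewrite -expRM_natl; congr expR; ring.
  have a0 : 0 <= a by rewrite divr_ge0 ?(ltW qp) //; lra.
  have aB : a <= B by apply: le_trans b1 _; exact: expR_ge1Dx.
  have sk0 : 0 <= s / kap by rewrite divr_ge0 // ltW.
  have bB : b <= B.
    rewrite ler_expR lerN2 invfM mulrA -mulrA mulrCA; lra.
  have ab : `|a - b| <= 4 * k%:R ^+ 2 * s ^+ 2.
    have := expRN_taylor1 sk0; rewrite -/b distrC => h.
    have : (s / kap) ^+ 2 <= k%:R ^+ 2 * s ^+ 2.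
      have k2 : 1 <= k%:R ^+ 2 :> R by rewrite exprn_ege1 // ler1n ltnW.
      apply: le_trans (_ : s ^+ 2 <= _); last by rewrite ler_peMl ?sqr_ge0.
      rewrite ler_sqr ?nnegrE // ler_pdivrMr // ler_peMr //.
    have := ler_distD (1 - s / kap) a b; lra.
  have -> : a ^+ m + mu ^+ m - b ^+ m = (a ^+ m - b ^+ m) + mu ^+ m by ring.
  apply: le_trans (ler_normD _ _) _; apply: lerD; last by lra.
  rewrite [leRHS]ger0_norm; last first.
    by rewrite mulr_ge0 ?expR_ge0 // mulr_ge0 // addr_ge0 // mulr_ge0 ?sqr_ge0.
  case: m m0 {sqm em0 mu1} => // m _.
  have B0 : 0 <= B by exact: expR_ge0.
  apply: le_trans (@normr_exprB R B a b m _ _) _; rewrite ?(ger0_norm a0) ?(ger0_norm (expR_ge0 _)) //.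
  have Bm : B ^+ m <= expR k%:R * expR (- ((2 * kap)^-1 * m.+1%:R * s)).
    rewrite -expRM_natl -expRD ler_expR -[m.+1%:R]natr1.
    have : s / (2 * kap) <= k%:R.
      rewrite ler_pdivrMr ?mulr_gt0 //; nra.
    rewrite (_ : (2 * kap)^-1 * (m%:R + 1) * s = m%:R * (s / (2 * kap)) + s / (2 * kap)); last by ring.
    by rewrite mulrN; lra.
  apply: le_trans (_ : m.+1%:R * (4 * k%:R ^+ 2 * s ^+ 2) *
      (expR k%:R * expR (- ((2 * kap)^-1 * m.+1%:R * s))) <= _).
    by apply: ler_pM => //; rewrite ?mulr_ge0 ?exprn_ge0 // ler_wpM2l.
  rewrite [leRHS](_ : _ = (4 * k%:R ^+ 2 * (m.+1%:R * s ^+ 2 + s)) *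
    (expR k%:R * expR (- ((2 * kap)^-1 * m.+1%:R * s)))); last by ring.
  apply: ler_wpM2r; first by rewrite mulr_ge0 ?expR_ge0.
  by rewrite mulrCA; apply: ler_wpM2l; [rewrite mulr_ge0 ?exprn_ge0|lra].
have E : expR (- (m%:R * s / kap)) <= expR (- (al * m%:R)).
  rewrite ler_expR lerN2 -mulrA mulrC ler_wpM2l //.
  apply: le_trans (_ : s0 <= _); first by rewrite ge_min lexx orbT.
  by rewrite ler_pM2r ?invr_gt0 //; lra.
have D : `|dickson q (2 * (k%:R - s)) m / q ^+ m| <= 2 * expR (- (al * m%:R)).
  have c1 : -1 <= (k%:R - s) / sq <= 1.
    rewrite ler_pdivrMr // mul1r (ltW cs) andbT.
    by apply: le_trans (_ : 0 <= _); [lra | rewrite divr_ge0 ?(ltW sqp) // subr_ge0].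
  have -> : 2 * (k%:R - s) = 2 * sq * cos (acos ((k%:R - s) / sq)).
    by rewrite acosK ?in_itv //=; field; rewrite gt_eqF.
  rewrite -[in dickson q]sq2 dickson_cos.
  rewrite (_ : _ / _ = 2 * (sq / q) ^+ m * cos (m%:R * acos ((k%:R - s) / sq))); last first.
    by rewrite expr_div_n; ring.
  rewrite normrM ger0_norm ?mulr_ge0 ?exprn_ge0 //.
  apply: le_trans (_ : 2 * (sq / q) ^+ m <= _); last by rewrite ler_wpM2l.
  by rewrite ler_piMr ?mulr_ge0 ?exprn_ge0 // cos_max.
have e0 := expR_ge0 (- (m%:R * s / kap)).
apply: le_trans (ler_normB _ _) _; rewrite [X in _ + X]ger0_norm //.
have : 0 <= `|4 * k%:R ^+ 2 * expR k%:R * (m%:R * s ^+ 2 + s) *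
   expR (- ((2 * kap)^-1 * m%:R * s))| by [].
lra.
Qed.

Definition full_box u := forall j, 0 <= u j <= 2.

Lemma cpolN (y : R) m : (0 < m)%N -> cpol k (- y) m = (-1) ^+ m * cpol k y m.
Proof.
case: m => // m _; rewrite !cpolE dicksonN.
have e2 : (-1) ^+ m.+1 * (-1) ^+ m.+1 = 1 :> R by rewrite -exprMn mulrNN mulr1 expr1n.
move: e2; set e := (-1) ^+ m.+1; set D := dickson _ _ _ => e2.
transitivity (e * D + (k%:R - 1) * (e + e * e)); last by ring.
by rewrite e2 [_ + 1]addrC.
Qed.

(** On [s <= k] the estimates above add up, [sin_prod] and the constant term of [cpolE] being
    negligible. On the other half, [u -> 2 - u] swaps [cos_prod] and [sin_prod] and multiplies the
    character sum by [(-1)^m], which reduces it to the first half. *)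
Lemma spectral_bound : exists C c : R, [/\ 0 <= C, 0 < c &
  forall m u, (0 < m)%N -> full_box u ->
  `|cpol k (2 * (k%:R - \sum_j u j)) m / q ^+ m
     - (cos_prod m u + (-1) ^+ m * sin_prod m u)| <=
  C / m%:R * (expR (- (c * m%:R * \sum_j u j))
    + expR (- (c * m%:R * \sum_j (2 - u j))))].
Proof.
have k1 := kap_ge1; have kp : 0 < kap by lra.
have qk := q_kap; have qp : 0 < q by lra.
have d1 : decays (fun m u => dickson q (2 * (k%:R - \sum_j u j)) m / q ^+ m - cos_prod m u).
  apply: (decaysD decays_dickson decays_cos_prod) => m u _ _.
  by apply: le_trans _ (ler_normB _ _); rewrite opprB addrA subrK.
have lq : 0 < ln q by rewrite ln_gt0 //; lra.
have d2 : decays (fun m u => kap * (1 + (-1) ^+ m) / q ^+ m : R).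
  apply: (@decays_exp _ (2 * kap) (ln q)) => //; first by rewrite mulr_ge0 // ltW.
  move=> m u _ _; rewrite normrM normfV (@ger0_norm _ (q ^+ m)) ?exprn_ge0 ?(ltW qp) //.
  rewrite [ln q * _]mulrC -mulrN expRM_natl expRN lnK ?posrE // exprVn.
  rewrite ler_pM2r ?invr_gt0 ?exprn_gt0 // normrM ger0_norm ?(ltW kp) //.
  rewrite mulrC ler_pM2r //; apply: le_trans (ler_normD _ _) _.
  by rewrite normr1 normrX normrN1 expr1n.
have d3 : decays (fun m u => cpol k (2 * (k%:R - \sum_j u j)) m / q ^+ m - cos_prod m u).
  apply: (decaysD d1 d2) => -[//|m] u _ _; rewrite cpolE -/q -/kap.
  by apply: le_trans _ (ler_normD _ _); rewrite mulrDl addrAC.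
have [C [c [C0 c0 H]]] : decays (fun m u =>
    cpol k (2 * (k%:R - \sum_j u j)) m / q ^+ m - (cos_prod m u + (-1) ^+ m * sin_prod m u)).
  apply: (decaysD d3 decays_sin_prod) => m u _ _.
  rewrite opprD addrA; apply: le_trans (ler_normB _ _) _.
  by rewrite normrM normrX normrN1 expr1n mul1r.
exists C, c; split=> // m u m0 bu.
have C1 : 0 <= C / m%:R by rewrite divr_ge0.
have [su|us] := leP (\sum_j u j) k%:R.
  apply: le_trans (H m u m0 (conj bu su)) _; rewrite ler_wpM2l // lerDl expR_ge0 //.
have S2 : \sum_j (2 - u j) = 2 * k%:R - \sum_j u j.
  by rewrite sumrB sumr_const card_ord mulr_natr.
have du : half_box (fun j => 2 - u j).
  split; last by rewrite S2; lra.
  by move=> j; have /andP[] := bu j => *; apply/andP; split; lra.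
have := H m _ m0 du; rewrite S2.
have -> : 2 * (k%:R - (2 * k%:R - \sum_j u j)) = - (2 * (k%:R - \sum_j u j)) by ring.
rewrite cpolN //.
have -> : cos_prod m (fun j => 2 - u j) = sin_prod m u.
  by apply: eq_bigr => j _; congr (_ ^+ _); field.
have -> : sin_prod m (fun j => 2 - u j) = cos_prod m u.
  by apply: eq_bigr => j _; congr (_ ^+ _); field.
have e2 : (-1) ^+ m * (-1) ^+ m = 1 :> R by rewrite -exprMn mulrNN mulr1 expr1n.
set X := cpol _ _ _; set P := cos_prod m u; set Q := sin_prod m u.
have -> : (-1) ^+ m * X / q ^+ m - (Q + (-1) ^+ m * P) =
    (-1) ^+ m * (X / q ^+ m - (P + (-1) ^+ m * Q)).
  by rewrite !mulrBr mulrDr [_ * (_ * Q)]mulrA e2 mul1r mulrA; ring.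
rewrite normrM normrX normrN1 expr1n mul1r => h.
by apply: le_trans h _; rewrite ler_wpM2l // lerDr expR_ge0.
Qed.

End SpectralBound.

(** * Comparison with binomials *)

Section LocalComparison.
Variables (k : nat) (R : realType).
Hypothesis hk : (2 <= k)%N.

Let q : R := 2 * k%:R - 1.

(** Let [u = 1 + e cos x] and let [n] be the integer part of [a]. For [u <= 1], [exp (- a u) <= (1 +
    u)^(-n) <= (1 - u / 2)^n], whose average is [pbin n 0]. For [u > 1] the bound [exp (- a)]
    suffices. *)
Lemma avg1_expR (e a : R) M : e * e = 1 -> 0 < a -> (Num.truncn a < M)%N ->
  avg1 M (fun x => expR (- (a * (1 + e * cos x)))) <= 2 / Num.sqrt a.
Proof.
move=> ee a0 nM; set n := Num.truncn a in nM.
have /andP[na an] := truncn_itv (ltW a0); rewrite -/n in na an.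
have ec (x : R) : `|e * cos x| <= 1.
  rewrite normrM (_ : `|e| = 1) ?mul1r ?cos_max //.
  by apply/eqP; rewrite -(@pexpr_eq1 _ _ 2) // -normrX expr2 ee normr1.
have M0 : (0 < M)%N by exact: leq_ltn_trans nM.
apply: le_trans (_ : avg1 M (fun x => ((1 + (- e) * cos x) / 2) ^+ n * cos (x * 0%:~R)
   + expR (- a)) <= _).
  apply: ler_avg1 => x; rewrite mulr0 cos0 mulr1.
  have := ec x; rewrite ler_norml => /andP[c1 c2].
  set u := 1 + e * cos x.
  have u0 : 0 <= u by rewrite /u; lra.
  have -> : (1 + - e * cos x) / 2 = 1 - u / 2 by rewrite /u; field.
  have p0 : 0 <= 1 - u / 2 by rewrite /u; lra.
  have [u1|u1] := leP u 1.
    apply: ler_wpDr; first exact: expR_ge0.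
    apply: le_trans (_ : expR (- u) ^+ n <= _).
      by rewrite -expRM_natl ler_expR mulrN lerN2 ler_wpM2r.
    rewrite lerXn2r ?nnegrE ?expR_ge0 //.
    have h := expR_ge1Dx u.
    apply: le_trans (_ : (1 + u)^-1 <= _).
      by rewrite expRN lef_pV2 ?posrE ?expR_gt0 //; lra.
    by rewrite -[leLHS]mul1r ler_pdivrMr; [nra|lra].
  apply: ler_wpDl; first exact: exprn_ge0.
  by rewrite ler_expR lerN2 ler_peMr ?(ltW a0) // ltW.
rewrite avg1D avg1_cst // avg_pbin ?mulrNN ?ee ?addn0 // expr0z mul1r.
have sa : 0 < Num.sqrt a by rewrite sqrtr_gt0.
have -> : 2 / Num.sqrt a = (Num.sqrt a)^-1 + (Num.sqrt a)^-1 by field; rewrite gt_eqF.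
apply: lerD.
  apply: le_trans (pbin0_le_invsqrt R n) _.
  by rewrite lef_pV2 ?posrE ?sqrtr_gt0 ?ltr0n // ler_wsqrtr // ltW.
rewrite expRN lef_pV2 ?posrE ?expR_gt0 //.
rewrite -[leRHS]ger0_norm ?expR_ge0 // -sqrtr_sqr ler_wsqrtr //.
have h := expR_ge1Dx a; rewrite expr2; nra.
Qed.

Lemma prodr_exprz (e : R) (b : 'I_k -> int) : e != 0 ->
  \prod_j e ^ b j = e ^ (\sum_j b j).
Proof.
move=> e0; apply/esym; apply: (big_morph (fun n : int => e ^ n)).
  by move=> i j; rewrite expfzDr.
exact: expr0z.
Qed.

(** Both terms are grid averages against [chi], so [spectral_bound] applies pointwise. The averages
    of its exponentials factor over the coordinates, each factor being [O(1 / sqrt m)]. *)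
Lemma cyc_count_pbin : exists2 C : R, 0 <= C & forall m (beta : 'rV[int]_k), (0 < m)%N ->
  `|cyc_count R m beta / q ^+ m
     - parity_factor R m beta * \prod_j pbin R (steps k m) (beta 0 j)|
  <= C / m%:R / Num.sqrt m%:R ^+ k.
Proof.
have [C [c [C0 c0 H]]] := spectral_bound R hk.
exists (C * (2 * (2 / Num.sqrt c) ^+ k)).
  by rewrite !mulr_ge0 ?exprn_ge0 // divr_ge0 ?sqrtr_ge0.
move=> m beta m0; have mp : 0 < m%:R :> R by rewrite ltr0n.
set N := steps k m.
(* The grid is fine enough for the counts, the binomials and [avg1_expR] at once. It depends on
   [beta], but the resulting bound does not involve [M]. *)
pose M := (norm1 beta + m + N + Num.truncn (c * m%:R)%R).+1.
have bM j : (N + `|beta 0%R j|%N < M)%N.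
  have : (`|beta 0%R j|%N <= norm1 beta)%N by rewrite /norm1 (bigD1 j) //= leq_addr.
  by rewrite /M; lia.
rewrite (@cyc_count_avg _ _ M) //; last by rewrite /M; lia.
pose u (x : 'I_k -> R) j := 1 - cos (x j).
have uS x : \sum_j u x j = k%:R - cos_sum x by rewrite sumrB sumr_const card_ord.
have ub x : full_box (u x).
  by move=> j; rewrite /u; have := cos_le1 (x j); have := cos_geN1 (x j) => *; apply/andP; split; lra.
have e1 : 1 * 1 = 1 :> R by rewrite mulr1.
have eN1 : -1 * -1 = 1 :> R by rewrite mulrNN mulr1.
have cP : \prod_j pbin R N (beta 0 j) = avg M (fun x => cos_prod m (u x) * chi x beta).
  have -> : \prod_j pbin R N (beta 0 j) = \prod_j avg1 M (fun y =>
      ((1 + 1 * cos y) / 2) ^+ N * cos (y * (beta 0 j)%:~R)).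
    by apply: eq_bigr => j _; rewrite avg_pbin // exp1rz mul1r.
  rewrite -avg_prod; apply: eq_avg => x; rewrite big_split; congr (_ * _).
  by apply: eq_bigr => j _; congr (_ ^+ _); rewrite /u; field.
have sP : (-1) ^ (\sum_j beta 0 j) * \prod_j pbin R N (beta 0 j) =
    avg M (fun x => sin_prod m (u x) * chi x beta).
  rewrite -prodr_exprz ?oppr_eq0 ?oner_eq0 // -big_split /=.
  have -> : \prod_j ((-1) ^ beta 0 j * pbin R N (beta 0 j)) = \prod_j avg1 M (fun y =>
      ((1 + -1 * cos y) / 2) ^+ N * cos (y * (beta 0 j)%:~R)).
    by apply: eq_bigr => j _; rewrite avg_pbin.
  rewrite -avg_prod; apply: eq_avg => x; rewrite big_split; congr (_ * _).
  by apply: eq_bigr => j _; congr (_ ^+ _); rewrite /u; field.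
have -> : parity_factor R m beta * \prod_j pbin R N (beta 0 j) =
    avg M (fun x => (cos_prod m (u x) + (-1) ^+ m * sin_prod m (u x)) * chi x beta).
  rewrite /parity_factor expfzDr ?oppr_eq0 ?oner_eq0 // mulrDl mul1r -mulrA sP.
  rewrite cP -avgZ -avgD; apply: eq_avg => x; rewrite mulrDl; congr (_ + _).
  by rewrite mulrA.
rewrite mulrC -avgZ -avgB.
apply: le_trans (ler_norm_avg _ _) _.
apply: le_trans (_ : avg M (fun x => C / m%:R * (\prod_j expR (- (c * m%:R * (1 + -1 * cos (x j))))
   + \prod_j expR (- (c * m%:R * (1 + 1 * cos (x j)))))) <= _).
  apply: ler_avg => x; rewrite mulrA -mulrBl normrM.
  apply: le_trans (_ : `|(q ^+ m)^-1 * cpol k (2 * cos_sum x) m -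
     (cos_prod m (u x) + (-1) ^+ m * sin_prod m (u x))| * 1 <= _).
    rewrite ler_wpM2l // /chi normr_prod.
    by apply: prodr_ile1 => j _; rewrite normr_ge0 cos_max.
  rewrite mulr1 mulrC; have := H m (u x) m0 (ub x).
  rewrite uS (_ : k%:R - (k%:R - cos_sum x) = cos_sum x); last by ring.
  move=> h; apply: le_trans h _; rewrite ler_wpM2l ?divr_ge0 // -uS.
  rewrite !mulr_sumr -!sumrN !expR_sum le_eqVlt; apply/orP; left; apply/eqP.
  by congr (_ + _); apply: eq_bigr => j _; congr (expR (- (_ * _))); rewrite /u; ring.
have cm0 : 0 < c * m%:R by rewrite mulr_gt0.
rewrite avgZ avgD.
rewrite (avg_prod M (fun _ y => expR (- (c * m%:R * (1 + -1 * cos y))))).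
rewrite (avg_prod M (fun _ y => expR (- (c * m%:R * (1 + 1 * cos y))))).
have tM : (Num.truncn (c * m%:R)%R < M)%N by rewrite /M; lia.
have avg1_ge0 f : (forall x, 0 <= f x) -> 0 <= avg1 M f :> R.
  by move=> f0; rewrite mulr_ge0 ?invr_ge0 // sumr_ge0.
rewrite !prodr_const card_ord.
have -> : C * (2 * (2 / Num.sqrt c) ^+ k) / m%:R / Num.sqrt m%:R ^+ k =
    C / m%:R * ((2 / Num.sqrt (c * m%:R)) ^+ k + (2 / Num.sqrt (c * m%:R)) ^+ k).
  rewrite sqrtrM ?(ltW c0) // !expr_div_n exprMn; field.
  by rewrite !expf_neq0 // !gt_eqF // sqrtr_gt0.
rewrite ler_wpM2l ?divr_ge0 //.
have b0 : 0 <= 2 / Num.sqrt (c * m%:R) by rewrite divr_ge0 ?sqrtr_ge0.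
apply: lerD; rewrite lerXn2r ?nnegrE ?avg1_ge0 //; try by move=> x; exact: expR_ge0.
  exact: avg1_expR.
exact: avg1_expR.
Qed.

End LocalComparison.

(** * Local limit theorem *)

Section LocalLimit.
Variables (k : nat) (R : realType).
Hypothesis hk : (2 <= k)%N.

Let q : R := 2 * k%:R - 1.
Let kap : R := k%:R - 1.
Let A : R := (Num.sqrt (2 * pi * kap^-1))^-1.

(** With [sigma^2 = 1 / kap] this is [exp (- b^2 / (2 sigma^2 m))], and [A] is
    [(2 pi sigma^2)^(-1/2)]. *)
Definition gauss1 (m : nat) (b : int) : R := expR (- (b%:~R ^+ 2 * kap / (2 * m%:R))).

Lemma gauss1_bounds m b : 0 <= gauss1 m b <= 1.
Proof.
have k1 := kap_ge1 R hk; rewrite expR_ge0 expR_le1 oppr_le0.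
by apply: divr_ge0 => //; apply: mulr_ge0; [exact: sqr_ge0 | rewrite /kap; lra].
Qed.

Lemma gauss_scale_gt0 : 0 < A.
Proof.
have k1 := kap_ge1 R hk.
by rewrite invr_gt0 sqrtr_gt0 !mulr_gt0 ?pi_gt0 ?invr_gt0 // /kap; lra.
Qed.

Lemma gauss_scale_sq : A ^+ 2 = kap / (2 * pi).
Proof.
have k1 := kap_ge1 R hk; have p0 := pi_gt0 R.
rewrite exprVn sqr_sqrtr; last by rewrite !mulr_ge0 ?pi_ge0 ?invr_ge0 // /kap; lra.
by field; rewrite !gt_eqF // /kap; lra.
Qed.

Lemma inv_le_invsqrt (x : R) : 1 <= x -> x^-1 <= (Num.sqrt x)^-1.
Proof.
move=> x1; have x0 : 0 < x by lra.
rewrite lef_pV2 ?posrE ?sqrtr_gt0 // -{2}(@sqr_sqrtr _ x) ?(ltW x0) // expr2.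
by rewrite ler_peMr ?sqrtr_ge0 // -[leLHS]sqrtr1 ler_wsqrtr.
Qed.

(** Three approximations are chained: [pbin_gauss], the replacement of [N] by [2 m / (k - 1)] in the
    exponent, and [y = sqrt m * pbin N 0] close to [A]. The last comes from [y^2 - A^2] by Wallis,
    divided by [y + A >= A]. *)
Lemma pbin_local_limit : exists2 K : R, 0 <= K & forall m (b : int), (k <= m)%N ->
  `|Num.sqrt m%:R * pbin R (steps k m) b - A * gauss1 m b| <= K / Num.sqrt m%:R.
Proof.
have k1 := kap_ge1 R hk; rewrite -/kap in k1; have kp : 0 < kap by lra.
have A0 := gauss_scale_gt0; have p0 := pi_gt0 R; have p2 := pi_ge2 R.
(* [6 kap] comes from [pbin_gauss], [kap] from the change of exponent and [2 kap / A] from [y - A].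
   The root of [kap] turns [1 / sqrt N] into [1 / sqrt m], as [m <= N kap]. *)
pose K := (7 * kap + 2 * kap / A) * Num.sqrt kap.
have K0' : 0 <= 7 * kap + 2 * kap / A.
  by rewrite addr_ge0 ?divr_ge0 ?mulr_ge0 ?(ltW A0) ?(ltW kp).
exists K; first by rewrite mulr_ge0 ?sqrtr_ge0.
move=> m b km; set N := steps k m.
have mp : 0 < m%:R :> R by rewrite ltr0n; lia.
have /andP[n1 n2] := steps_bounds R hk m; rewrite -/kap -/N in n1 n2.
have mk : kap + 1 <= m%:R by rewrite /kap subrK ler_nat.
have Nm : m%:R <= N%:R * kap by lra.
have Np : 0 < N%:R :> R by rewrite -(pmulr_lgt0 _ kp); lra.
have N0 : (0 < N)%N by rewrite -(ltr0n R).
have N1 : 1 <= N%:R :> R by rewrite ler1n.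
set sN := Num.sqrt (N%:R : R); set sm := Num.sqrt (m%:R : R).
have sN0 : 0 < sN by rewrite sqrtr_gt0.
have sm0 : 0 < sm by rewrite sqrtr_gt0.
have NsN : N%:R^-1 <= sN^-1 by exact: inv_le_invsqrt.
pose y := sm * pbin R N 0.
have y0 : 0 <= y by rewrite mulr_ge0 ?pbin_ge0 ?ltW.
have y2 : y ^+ 2 = (m%:R / N%:R) * (pi * N%:R * pbin R N 0 ^+ 2) / pi.
  have sm2 : sm ^+ 2 = m%:R by rewrite sqr_sqrtr ?(ltW mp).
  have alg (a c d p : R) : a != 0 -> c != 0 ->
      d * p ^+ 2 = d / c * (a * c * p ^+ 2) / a.
    by move=> a0 c0; field; rewrite a0 c0.
  by rewrite /y exprMn sm2; apply: alg; rewrite gt_eqF.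
have /andP[w1 w2] := pbin0_wallis R N0; set W := pi * _ * _ in w1 w2 y2.
have w1' : 1 - N%:R^-1 <= W.
  apply: le_trans w1; rewrite natrD natrM ler_pdivlMr; last by lra.
  have E : N%:R^-1 * N%:R = 1 :> R by rewrite mulVf // gt_eqF.
  have : 0 <= N%:R^-1 :> R by rewrite invr_ge0.
  lra.
have r1 : kap / 2 <= m%:R / N%:R by rewrite ler_pdivlMr //; lra.
have r2 : m%:R / N%:R <= kap / 2 + kap / 2 * N%:R^-1.
  rewrite ler_pdivrMr // mulrDl divfK ?gt_eqF //; lra.
have r3 : m%:R / N%:R <= kap.
  have : N%:R^-1 <= 1 :> R by rewrite invf_le1.
  by nra.
have W0 : 0 <= W.
  by rewrite /W; apply: mulr_ge0; [apply: mulr_ge0 => //; exact: ltW | exact: sqr_ge0].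
have y2k : y ^+ 2 <= kap.
  rewrite y2 ler_pdivrMr //; apply: le_trans (_ : kap * 1 <= _).
    by rewrite ler_pM // divr_ge0.
  by rewrite ler_pM2l //; lra.
have yk : y <= kap.
  by rewrite -ler_sqr ?nnegrE ?(ltW kp) // (le_trans y2k) // expr2 ler_peMr // ltW.
have iN : 0 <= N%:R^-1 :> R by rewrite invr_ge0.
have yA2 : `|y ^+ 2 - A ^+ 2| <= 2 * kap * N%:R^-1.
  have -> : y ^+ 2 - A ^+ 2 = (m%:R / N%:R * W - kap / 2) / pi.
    have alg (a c d : R) : a != 0 -> c / a - d / (2 * a) = (c - d / 2) / a.
      by move=> a0; field.
    by rewrite y2 gauss_scale_sq; apply: alg; rewrite gt_eqF.
  rewrite normrM [X in _ * X]ger0_norm ?invr_ge0 ?(ltW p0) // ler_pdivrMr //.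
  apply: le_trans (_ : 2 * kap * N%:R^-1 <= _); last first.
    by rewrite ler_peMr ?mulr_ge0 ?(ltW kp) //; lra.
  have e1 : 0 <= (m%:R / N%:R) * (1 - W) <= kap * N%:R^-1.
    by rewrite mulr_ge0 ?divr_ge0 ?subr_ge0 //= ler_pM ?divr_ge0 ?subr_ge0 //; lra.
  case/andP: e1 => e1 e2.
  have kN : 0 <= kap * N%:R^-1 by rewrite mulr_ge0 // ltW.
  by rewrite ler_norml; apply/andP; split; lra.
have yA : `|y - A| <= 2 * kap / A * sN^-1.
  have : `|y - A| * A <= `|y ^+ 2 - A ^+ 2|.
    rewrite subr_sqr normrM ler_wpM2l // ger0_norm ?addr_ge0 ?(ltW A0) //; lra.
  move=> h; rewrite -(ler_pM2r A0) (le_trans h) // (le_trans yA2) //.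
  by rewrite [leRHS]mulrAC divfK ?gt_eqF // ler_wpM2l // mulr_ge0 // ltW.
pose x := b%:~R ^+ 2 * kap / (2 * m%:R) : R; pose X := b%:~R ^+ 2 / N%:R : R.
have x0 : 0 <= x.
  by apply: divr_ge0 => //; apply: mulr_ge0; [exact: sqr_ge0 | exact: ltW].
have XE : X = x * (2 * m%:R / kap / N%:R) by rewrite /X /x; field; rewrite !gt_eqF.
have z1 : 1 <= 2 * m%:R / kap / N%:R by rewrite ler_pdivlMr // mul1r ler_pdivlMr.
have z2 : 2 * m%:R / kap / N%:R <= 1 + N%:R^-1.
  by rewrite ler_pdivrMr // [leRHS]mulrDl mul1r mulVf ?gt_eqF // ler_pdivrMr // ltW.
have gg : `|expR (- X) - gauss1 m b| <= sN^-1.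
  rewrite /gauss1 -/x distrC ger0_norm; last first.
    by rewrite subr_ge0 ler_expR lerN2 XE ler_peMr.
  apply: le_trans (subr_expRN_le _ _) _; apply: le_trans NsN.
  apply: le_trans (_ : (x * N%:R^-1) * expR (- x) <= _).
    rewrite ler_wpM2r ?expR_ge0 // XE; nra.
  rewrite mulrAC ler_piMl // expRN ler_pdivrMr ?expR_gt0 // mul1r.
  by apply: le_trans (expR_ge1Dx x); lra.
have pg := @pbin_gauss R N b N0.
have /andP[g0 g1] := gauss1_bounds m b.
have e1 : `|sm * pbin R N b - y * expR (- X)| <= kap * (6 * sN^-1).
  rewrite /y -mulrA -mulrBr normrM ger0_norm ?(ltW sm0) //.
  apply: le_trans (_ : sm * (pbin R N 0 * (6 / sN)) <= _); first by rewrite ler_pM2l.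
  by rewrite mulrA ler_wpM2r // mulr_ge0 // invr_ge0 ltW.
have e2 : `|y * (expR (- X) - gauss1 m b)| <= kap * sN^-1.
  by rewrite normrM ger0_norm // ler_pM.
have e3 : `|(y - A) * gauss1 m b| <= 2 * kap / A * sN^-1.
  by rewrite normrM (ger0_norm g0); apply: le_trans yA; rewrite ler_piMr.
have -> : sm * pbin R N b - A * gauss1 m b = (sm * pbin R N b - y * expR (- X))
   + y * (expR (- X) - gauss1 m b) + (y - A) * gauss1 m b by ring.
apply: le_trans (ler_normD _ _) _; apply: le_trans (lerD (ler_normD _ _) (lexx _)) _.
apply: le_trans (_ : (7 * kap + 2 * kap / A) * sN^-1 <= _); first by lra.
rewrite /K -[leRHS]mulrA ler_wpM2l // ler_pdivlMr // mulrC ler_pdivrMr //.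
by rewrite /sN /sm -sqrtrM ?(ltW kp) // ler_wsqrtr // mulrC.
Qed.

Definition gauss (m : nat) (beta : 'rV[int]_k) : R := A ^+ k * \prod_j gauss1 m (beta 0 j).

Lemma gaussE m beta :
  gauss m beta = A ^+ k * expR (- (inner R beta * kap / (2 * m%:R))).
Proof.
rewrite /gauss -expR_sum; congr (_ * expR _).
rewrite sumrN /inner rmorph_sum /= !mulr_suml; congr (- _).
by apply: eq_bigr => j _; rewrite intrM expr2.
Qed.

Lemma pbin_local_limit_multi : exists2 K : R, 0 <= K & forall m (beta : 'rV[int]_k),
  (k <= m)%N ->
  `|Num.sqrt m%:R ^+ k * \prod_j pbin R (steps k m) (beta 0 j) - gauss m beta|
    <= K / Num.sqrt m%:R.
Proof.
have [K K0 HK] := pbin_local_limit; have A0 := gauss_scale_gt0.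
pose B := 1 + A + K.
have B1 : 1 <= B by rewrite /B; lra.
exists (B ^+ k * (k%:R * K)); first by rewrite !mulr_ge0 ?exprn_ge0 //; lra.
move=> m beta km; have m1 : 1 <= m%:R :> R by rewrite ler1n; lia.
have sm1 : 1 <= Num.sqrt m%:R :> R by rewrite -[leLHS]sqrtr1 ler_wsqrtr.
have gb j : `|A * gauss1 m (beta 0 j)| <= A.
  have /andP[g0 g1] := gauss1_bounds m (beta 0 j).
  by rewrite normrM ger0_norm ?(ltW A0) // ler_piMr ?(ltW A0) // ger0_norm.
have Kb : K / Num.sqrt m%:R <= K by rewrite ler_pdivrMr ?ler_peMr //; lra.
have pb j : `|Num.sqrt m%:R * pbin R (steps k m) (beta 0 j)| <= B.
  have := HK m (beta 0 j) km; have := gb j.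
  set X := _ * pbin _ _ _; set Y := A * _ => h1 h2.
  by rewrite -(subrK Y X); apply: le_trans (ler_normD _ _) _; rewrite /B; lra.
have scale (c : R) (f : 'I_k -> R) : c ^+ k * \prod_j f j = \prod_j (c * f j).
  by rewrite big_split /= prodr_const card_ord.
rewrite /gauss !scale.
apply: le_trans (normr_prodB _ B1 pb _) _.
  by move=> j; apply: le_trans (gb j) _; rewrite /B; lra.
have -> : size (index_enum 'I_k) = k.
  by rewrite [index_enum _]unlock -enumT size_enum_ord.
rewrite -[leRHS]mulrA ler_wpM2l ?exprn_ge0 //; first lra.
apply: le_trans (_ : \sum_(j < k) (K / Num.sqrt m%:R) <= _).
  by apply: ler_sum => j _; exact: HK.
by rewrite sumr_const card_ord -[_ *+ k]mulr_natl mulrA.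
Qed.

Lemma parity_factor_le m (beta : 'rV[int]_k) : `|parity_factor R m beta| <= 2.
Proof.
rewrite /parity_factor; set z := (X in _ ^ X).
apply: le_trans (ler_normD _ _) _; rewrite normr1.
have -> : `|(-1 : R) ^ z| = 1.
  apply/eqP; rewrite -(@pexpr_eq1 _ _ 2) // -normrX expr2 -expfzMl.
  by rewrite mulrNN mulr1 exp1rz normr1.
lra.
Qed.

Lemma parity_factorS m (beta : 'rV[int]_k) :
  parity_factor R m beta + parity_factor R m.+1 beta = 2.
Proof.
rewrite /parity_factor; set S := \sum_i _.
rewrite (_ : m.+1%:Z + S = m%:Z + S + 1); last by rewrite -addn1 PoszD; ring.
by rewrite (expfzDr (m%:Z + S) 1) ?oppr_eq0 ?oner_eq0 // expr1z; ring.
Qed.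

Lemma cyc_count_local_limit : exists2 K : R, 0 <= K & forall m (beta : 'rV[int]_k),
  (k <= m)%N ->
  `|Num.sqrt m%:R ^+ k * (cyc_count R m beta / q ^+ m) - parity_factor R m beta * gauss m beta|
    <= K / Num.sqrt m%:R.
Proof.
have [C C0 HC] := @cyc_count_pbin k R hk; have [K K0 HK] := pbin_local_limit_multi.
exists (C + 2 * K); first by rewrite addr_ge0 ?mulr_ge0.
move=> m beta km; have m0 : (0 < m)%N by lia.
have m1 : 1 <= m%:R :> R by rewrite ler1n.
set s := Num.sqrt m%:R; have s0 : 0 < s by rewrite sqrtr_gt0; lra.
set p := parity_factor R m beta; set P := \prod_j pbin R (steps k m) (beta 0 j).
have -> : s ^+ k * (cyc_count R m beta / q ^+ m) - p * gauss m beta =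
  s ^+ k * (cyc_count R m beta / q ^+ m - p * P) + p * (s ^+ k * P - gauss m beta) by ring.
apply: le_trans (ler_normD _ _) _; rewrite [leRHS]mulrDl !normrM; apply: lerD.
  rewrite (@ger0_norm _ (s ^+ k)) ?exprn_ge0 ?(ltW s0) //.
  apply: le_trans (_ : s ^+ k * (C / m%:R / s ^+ k) <= _).
    by rewrite ler_wpM2l ?exprn_ge0 ?(ltW s0) // HC.
  rewrite mulrC divfK ?expf_neq0 ?gt_eqF // ler_wpM2l //.
  exact: inv_le_invsqrt.
by rewrite -mulrA ler_pM ?parity_factor_le // HK.
Qed.

End LocalLimit.

(** * Cumulative counts *)

Section CumulativeLimit.
Variables (k : nat) (R : realType).
Hypothesis hk : (2 <= k)%N.

Let q : R := 2 * k%:R - 1.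
Let kap : R := k%:R - 1.
Let A : R := (Num.sqrt (2 * pi * kap^-1))^-1.
Let s (m : nat) : R := Num.sqrt m%:R.
Let h m (beta : 'rV[int]_k) : R := cyc_count R m beta / q ^+ m.

Let s_gt0 m : (0 < m)%N -> 0 < s m.
Proof. by move=> m0; rewrite sqrtr_gt0 ltr0n. Qed.

Let s_le m n : (m <= n)%N -> s m <= s n.
Proof. by move=> mn; rewrite ler_wsqrtr // ler_nat. Qed.

Let s_sq m : s m ^+ 2 = m%:R.
Proof. by rewrite sqr_sqrtr. Qed.

Let inv_le_invs m : (0 < m)%N -> m%:R^-1 <= (s m)^-1.
Proof. by move=> m0; apply: inv_le_invsqrt; rewrite ler1n. Qed.

Lemma gauss_le m (beta : 'rV[int]_k) : 0 <= gauss R m beta <= A ^+ k.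
Proof.
have A0 : 0 <= A ^+ k by rewrite exprn_ge0 // ltW // gauss_scale_gt0.
have g01 j : 0 <= gauss1 k R m (beta 0 j) <= 1 by exact: gauss1_bounds.
rewrite mulr_ge0 //=; last by apply: prodr_ge0 => j _; case/andP: (g01 j).
by rewrite ler_piMr //; apply: prodr_ile1 => j _; exact: g01.
Qed.

(** The exponents differ by [b / m], where [b] is the smaller one, and [b exp (- b) <= 1] makes the
    bound uniform in [beta]. *)
Lemma gaussS m (beta : 'rV[int]_k) : (0 < m)%N ->
  `|gauss R m.+1 beta - gauss R m beta| <= A ^+ k / m%:R.
Proof.
move=> m0; have mp : 0 < m%:R :> R by rewrite ltr0n.
have A0 : 0 <= A ^+ k by rewrite exprn_ge0 // ltW // gauss_scale_gt0.
have k1 := kap_ge1 R hk.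
rewrite !gaussE -mulrBr normrM ger0_norm // ler_wpM2l //.
set T := inner R beta * _.
have T0 : 0 <= T.
  rewrite mulr_ge0 //; last by lra.
  by rewrite /inner ler0z sumr_ge0 // => j _; rewrite -expr2 sqr_ge0.
have p1 : 0 < 2 * m%:R :> R by rewrite mulr_gt0.
have p2 : 0 < 2 * m.+1%:R :> R by rewrite mulr_gt0.
have le : T / (2 * m.+1%:R) <= T / (2 * m%:R).
  by rewrite ler_wpM2l // lef_pV2 ?posrE // ler_pM2l // ler_nat.
rewrite ger0_norm; last by rewrite subr_ge0 ler_expR lerN2.
apply: le_trans (subr_expRN_le _ _) _.
set b := T / (2 * m.+1%:R) in le *.
have b0 : 0 <= b by rewrite divr_ge0 // ltW.
have -> : T / (2 * m%:R) - b = b / m%:R.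
  by rewrite /b -natr1; field; rewrite nat1r !pnatr_eq0 -lt0n m0.
rewrite mulrAC ler_piMl ?invr_ge0 // expRN ler_pdivrMr ?expR_gt0 // mul1r.
by apply: le_trans (expR_ge1Dx b); lra.
Qed.

Lemma exprB1_le (B x : R) : 1 <= B -> 0 <= x <= B ->
  `|x ^+ k - 1| <= k%:R * B ^+ k * `|x - 1|.
Proof.
move=> B1 /andP[x0 xB].
have [k' kE] : exists k', k = k'.+1 by exists k.-1; lia.
rewrite -[X in `|_ - X|](expr1n _ k) kE.
apply: le_trans (@normr_exprB R B x 1 k' _ _) _; rewrite ?normr1 ?(ger0_norm x0) //.
rewrite mulrAC ler_wpM2r // ler_wpM2l // exprS ler_peMl // exprn_ge0 //; lra.
Qed.

Lemma sqrt_ratio m : (0 < m)%N -> 1 - m%:R^-1 <= s m / s m.+1 <= 1.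
Proof.
move=> m0; have mp : 0 < m%:R :> R by rewrite ltr0n.
have sm := s_gt0 m0; have sm1 : 0 < s m.+1 by exact: s_gt0.
have r1 : s m / s m.+1 <= 1 by rewrite ler_pdivrMr // mul1r s_le.
rewrite r1 andbT; apply: le_trans (_ : (s m / s m.+1) ^+ 2 <= _).
  rewrite expr_div_n !s_sq -natr1 ler_pdivlMr; last by lra.
  have E : m%:R^-1 * m%:R = 1 :> R by rewrite mulVf // gt_eqF.
  have : 0 <= m%:R^-1 :> R by rewrite invr_ge0.
  lra.
by rewrite expr2 ler_piMl // divr_ge0 // ltW.
Qed.

Lemma sqrt_ratioV m : (0 < m)%N -> 1 <= s m.+1 / s m <= 1 + m%:R^-1.
Proof.
move=> m0; have mp : 0 < m%:R :> R by rewrite ltr0n.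
have sm := s_gt0 m0; have sm1 : 0 < s m.+1 by exact: s_gt0.
have r1 : 1 <= s m.+1 / s m by rewrite ler_pdivlMr // mul1r s_le.
rewrite r1 /=; apply: le_trans (_ : (s m.+1 / s m) ^+ 2 <= _).
  by rewrite expr2 ler_peMr // (le_trans ler01).
by rewrite expr_div_n !s_sq -natr1 mulrDl mul1r mulfV ?gt_eqF.
Qed.

(** The two parity factors add up to 2, so the mean of two consecutive densities has a limit free of
    parity. *)
Lemma pair_local_limit : exists2 K : R, 0 <= K & forall m (beta : 'rV[int]_k),
  (k <= m)%N ->
  `|s m ^+ k * ((h m beta + h m.+1 beta) / 2) - gauss R m beta| <= K / s m.
Proof.
have [K K0 HK] := cyc_count_local_limit R hk.
have A0 : 0 <= A ^+ k by rewrite exprn_ge0 // ltW // gauss_scale_gt0.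
exists (K + (1 + k%:R) * A ^+ k); first by rewrite addr_ge0 // mulr_ge0 // addr_ge0.
move=> m beta km; have m0 : (0 < m)%N by lia.
have mp : 0 < m%:R :> R by rewrite ltr0n.
have sm := s_gt0 m0; have sm1 : 0 < s m.+1 by exact: s_gt0.
have /andP[x1 x2] := sqrt_ratio m0.
pose x := s m / s m.+1; rewrite -/x in x1 x2.
have x0 : 0 <= x by rewrite divr_ge0 // ltW.
have xk0 : 0 <= x ^+ k by exact: exprn_ge0.
have xk1 : x ^+ k <= 1 by exact: exprn_ile1.
have xk2 : `|x ^+ k - 1| <= k%:R / m%:R.
  apply: le_trans (exprB1_le (lexx 1) _) _; first by rewrite x0.
  rewrite expr1n mulr1 ler_wpM2l // ler_norml; apply/andP; split; last first.
    by apply: le_trans (_ : 0 <= _); [lra | rewrite invr_ge0].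
  by lra.
have h1 := HK m beta km; have h2 := HK m.+1 beta (leqW km).
have g1 := gaussS beta m0; have /andP[g2 g3] := gauss_le m.+1 beta.
have pp := parity_factorS R m beta.
have p1 := parity_factor_le R m.+1 beta.
rewrite -/(h m beta) -/(s m) in h1; rewrite -/(h m.+1 beta) -/(s m.+1) in h2.
have -> : s m ^+ k * ((h m beta + h m.+1 beta) / 2) =
    (s m ^+ k * h m beta + x ^+ k * (s m.+1 ^+ k * h m.+1 beta)) / 2.
  rewrite /x expr_div_n; field; rewrite expf_neq0 // gt_eqF //.
move: h1 h2 g1 g2 g3 pp p1.
set g := gauss R m beta; set g' := gauss R m.+1 beta.
set a := s m ^+ k * _; set b := s m.+1 ^+ k * _.
set p := parity_factor R m beta; set p' := parity_factor R m.+1 beta.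
set xk := x ^+ k in xk0 xk1 xk2 *.
move=> h1 h2 g1 g2 g3 pp p1.
(* Using [p + p' = 2], the error splits into the two local limit errors, the change of the Gaussian
   from [m] to [m.+1], and the change of scale. *)
have -> : (a + xk * b) / 2 - g = (a - p * g) / 2 + xk * (b - p' * g') / 2
    + p' * (g' - g) / 2 + (xk - 1) * (p' * g') / 2.
  have -> : p = 2 - p' by lra.
  by field.
have is1 : (s m.+1)^-1 <= (s m)^-1 by rewrite lef_pV2 ?posrE // s_le.
have is0 : 0 <= (s m)^-1 by rewrite invr_ge0 ltW.
have im := inv_le_invs m0.
have t1 : `|(a - p * g) / 2| <= K / s m / 2.
  by rewrite normrM [X in _ * X]ger0_norm ?invr_ge0 // ler_pM2r ?invr_gt0.
have t2 : `|xk * (b - p' * g') / 2| <= K / s m / 2.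
  rewrite normrM [X in _ * X]ger0_norm ?invr_ge0 // ler_pM2r ?invr_gt0 //.
  rewrite normrM (ger0_norm xk0); apply: le_trans (_ : `|b - p' * g'| <= _).
    by rewrite ler_piMl.
  by apply: le_trans h2 _; rewrite ler_wpM2l.
have t3 : `|p' * (g' - g) / 2| <= A ^+ k / s m.
  rewrite normrM [X in _ * X]ger0_norm ?invr_ge0 // ler_pdivrMr // mulrC normrM.
  rewrite ler_pM //; last first.
  by apply: le_trans g1 _; rewrite ler_wpM2l.
have t4 : `|(xk - 1) * (p' * g') / 2| <= k%:R * A ^+ k / s m.
  have pg : `|p' * g'| <= 2 * A ^+ k.
    by rewrite normrM (ger0_norm g2); apply: ler_pM.
  rewrite normrM [X in _ * X]ger0_norm ?invr_ge0 // ler_pdivrMr // normrM.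
  rewrite [leRHS](_ : _ = k%:R / s m * (2 * A ^+ k)); last by ring.
  apply: ler_pM => //; apply: le_trans xk2 _.
  by rewrite ler_wpM2l.
apply: le_trans (ler_normD _ _) _; apply: le_trans (lerD (ler_normD _ _) t4) _.
apply: le_trans (lerD (lerD (ler_normD _ _) t3) (lexx _)) _.
apply: le_trans (lerD (lerD (lerD t1 t2) (lexx _)) (lexx _)) _.
by rewrite le_eqVlt; apply/orP; left; apply/eqP; field; rewrite gt_eqF.
Qed.

(** Uniformity in [beta] is the point: it starts the induction of [cumulative_local_limit]. The
    number of all words serves as a bound. *)
Lemma N_count_bounded m : exists B : nat, forall beta : 'rV[int]_k, (N_count beta m <= B)%N.
Proof.
have nb j (beta : 'rV[int]_k) : (n_count beta j <= size (words k j))%N.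
  rewrite -(ler_nat R) n_countE -sum1_size natr_sum; apply: ler_sum => w _.
  by rewrite lern1 leq_b1.
elim: m => [|m [B IHB]].
  exists (size (words k 0)) => beta; apply: leq_trans (nb 0%N beta).
  rewrite /N_count /n_count; apply/eq_leq; congr (#|` fset_set _|%fset).
  by apply/seteqP; split => x /= [] ?; rewrite ?leqn0 => hx ?; split=> //;
    [exact/eqP | exact/eqP].
exists (B + size (words k m.+1))%N => beta; rewrite N_countS.
by apply: leq_add.
Qed.

Let T m (beta : 'rV[int]_k) : R := (N_count beta m)%:R / (q ^+ m.+1 / (q - 1))
   + (N_count beta m.+1)%:R / (q ^+ m.+2 / (q - 1)).

Lemma q_ge3 : 3 <= q.
Proof. by have : 2 <= k%:R :> R by [rewrite ler_nat]; rewrite /q; lra. Qed.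

Lemma cumulative_rec m (beta : 'rV[int]_k) :
  T m.+1 beta = T m beta / q + (q - 1) / q * (h m.+1 beta + h m.+2 beta).
Proof.
have q3 := q_ge3; have q0 : q != 0 by rewrite gt_eqF //; lra.
have q1 : q - 1 != 0 by rewrite gt_eqF //; lra.
rewrite /T /h -!n_countE (N_countS m.+1) (N_countS m) !natrD !exprS.
by field; rewrite q1 q0 expf_neq0.
Qed.

(** In [cumulative_rec] the weights [1 / q] and [(q - 1) / q] add up to 1, so the Gaussian satisfies
    the rescaled recursion up to [O(1 / m)]. The error [X] therefore contracts, up to a forcing term
    of order [1 / sqrt m]. *)
Lemma cumulative_local_limit : exists2 L : R, 0 <= L &
  forall m (beta : 'rV[int]_k), (k * 2 ^ k <= m)%N ->
  `|s m ^+ k / 2 * T m beta - gauss R m beta| <= L / s m.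
Proof.
have [K K0 HK] := pair_local_limit.
have A0 : 0 <= A ^+ k by rewrite exprn_ge0 // ltW // gauss_scale_gt0.
have q3 := q_ge3; have qp : 0 < q by lra.
set M0 := (k * 2 ^ k)%N.
have k2 : (4 <= 2 ^ k)%N by rewrite (@leq_exp2l 2 2).
have M08 : (8 <= M0)%N by rewrite /M0; apply: (@leq_mul 2 4).
have kM0 : (k <= M0)%N by rewrite /M0 leq_pmulr // expn_gt0.
pose K3 := 2 * (k%:R * 2 ^+ k + 1) * A ^+ k + K.
have K30 : 0 <= K3.
  by rewrite addr_ge0 // mulr_ge0 // mulr_ge0 // addr_ge0 // mulr_ge0 // exprn_ge0.
have [B HB] := N_count_bounded M0; have [B' HB'] := N_count_bounded M0.+1.
pose X m beta := s m ^+ k / 2 * T m beta - gauss R m beta.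
have rec m (beta : 'rV[int]_k) : (M0 <= m)%N ->
    `|X m.+1 beta| <= 2 / 3 * `|X m beta| + K3 / s m.+1.
  move=> Mm; have m0 : (0 < m)%N by lia.
  have mp : 0 < m%:R :> R by rewrite ltr0n.
  have sm := s_gt0 m0; have sm1 : 0 < s m.+1 by exact: s_gt0.
  have im0 : 0 <= m%:R^-1 :> R by rewrite invr_ge0.
  have im1 : m%:R^-1 <= 1 :> R by rewrite invf_le1 // ler1n.
  have /andP[r1 r2] := sqrt_ratioV m0.
  set r := s m.+1 / s m in r1 r2.
  have rk : `|r ^+ k - 1| <= k%:R * 2 ^+ k * m%:R^-1.
    apply: le_trans (@exprB1_le 2 r _ _) _; [lra| |].
      by apply/andP; split; lra.
    by rewrite ler_wpM2l ?mulr_ge0 ?exprn_ge0 // ger0_norm; lra.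
  (* The threshold [k 2^k] gives [r^k <= 2]; with [q >= 3] the contraction factor is at most 2/3. *)
  have rk2 : r ^+ k <= 2.
    have : k%:R * 2 ^+ k * m%:R^-1 <= 1 :> R.
      by rewrite ler_pdivrMr // mul1r -natrX -natrM ler_nat.
    by move=> h1; move: (le_trans rk h1); rewrite ler_norml => /andP[_]; lra.
  have rk0 : 0 <= r ^+ k by rewrite exprn_ge0 //; lra.
  have hd := HK m.+1 beta (leq_trans kM0 (leqW Mm)).
  have g1 := gaussS beta m0; have /andP[g2 g3] := gauss_le m beta.
  have -> : X m.+1 beta = r ^+ k / q * X m beta
     + ((r ^+ k - 1) * gauss R m beta - (gauss R m.+1 beta - gauss R m beta)) / q
     + (q - 1) / q * (s m.+1 ^+ k * ((h m.+1 beta + h m.+2 beta) / 2) - gauss R m.+1 beta).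
    rewrite /X cumulative_rec /r expr_div_n; field.
    by rewrite expf_neq0 ?gt_eqF.
  have im : m%:R^-1 <= 2 / s m.+1.
    apply: le_trans (_ : 2 / m.+1%:R <= _); last by rewrite ler_pM2l // inv_le_invs.
    rewrite ler_pdivlMr ?ltr0n // mulrC ler_pdivrMr // -natr1.
    have : 1 <= m%:R :> R by rewrite ler1n.
    lra.
  have t1 : `|r ^+ k / q * X m beta| <= 2 / 3 * `|X m beta|.
    rewrite normrM ler_wpM2r // ger0_norm ?divr_ge0 ?(ltW qp) //.
    by rewrite ler_pdivrMr //; lra.
  have t2 : `|((r ^+ k - 1) * gauss R m beta - (gauss R m.+1 beta - gauss R m beta)) / q|
      <= 2 * (k%:R * 2 ^+ k + 1) * A ^+ k / s m.+1.
    rewrite normrM normfV (ger0_norm (ltW qp)) ler_pdivrMr //.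
    apply: le_trans (ler_normB _ _) _; rewrite normrM (ger0_norm g2).
    apply: le_trans (_ : k%:R * 2 ^+ k * m%:R^-1 * A ^+ k + A ^+ k / m%:R <= _).
      by apply: lerD => //; apply: ler_pM.
    rewrite [leLHS](_ : _ = (k%:R * 2 ^+ k + 1) * A ^+ k * m%:R^-1); last by ring.
    apply: le_trans (_ : (k%:R * 2 ^+ k + 1) * A ^+ k * (2 / s m.+1) <= _).
      by rewrite ler_wpM2l // mulr_ge0 // addr_ge0 // mulr_ge0 // exprn_ge0.
    rewrite [leLHS](_ : _ = 2 * (k%:R * 2 ^+ k + 1) * A ^+ k / s m.+1); last by ring.
    rewrite ler_peMr //; last by lra.
    by rewrite divr_ge0 ?(ltW sm1) // mulr_ge0 // mulr_ge0 // addr_ge0 // mulr_ge0 // exprn_ge0.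
  have t3 : `|(q - 1) / q * (s m.+1 ^+ k * ((h m.+1 beta + h m.+2 beta) / 2)
      - gauss R m.+1 beta)| <= K / s m.+1.
    rewrite normrM; apply: le_trans hd; rewrite ler_piMl // ger0_norm.
      by rewrite ler_pdivrMr //; lra.
    by rewrite divr_ge0 ?(ltW qp) //; lra.
  apply: le_trans (ler_normD _ _) _; apply: le_trans (lerD (ler_normD _ _) t3) _.
  apply: le_trans (lerD (lerD t1 t2) (lexx _)) _.
  by rewrite -addrA lerD2l /K3 [leRHS]mulrDl.
have [D D0 HD] : exists2 D : R, 0 <= D & forall beta : 'rV[int]_k, `|X M0 beta| <= D.
  have c1 : 0 < q ^+ M0.+1 / (q - 1) by rewrite divr_gt0 ?exprn_gt0 //; lra.
  have c2 : 0 < q ^+ M0.+2 / (q - 1) by rewrite divr_gt0 ?exprn_gt0 //; lra.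
  have sk : 0 <= s M0 ^+ k / 2 by rewrite divr_ge0 // exprn_ge0 // sqrtr_ge0.
  pose E := s M0 ^+ k / 2 * (B%:R / (q ^+ M0.+1 / (q - 1)) + B'%:R / (q ^+ M0.+2 / (q - 1))).
  have E0 : 0 <= E by rewrite mulr_ge0 // addr_ge0 // divr_ge0 // ltW.
  exists (E + A ^+ k); first by rewrite addr_ge0.
  move=> beta; apply: le_trans (ler_normB _ _) _.
  have /andP[g2 g3] := gauss_le M0 beta; rewrite (ger0_norm g2) lerD //.
  have T0 : 0 <= T M0 beta by rewrite addr_ge0 // divr_ge0 // ltW.
  rewrite ger0_norm; last exact: mulr_ge0.
  apply: ler_wpM2l => //; apply: lerD.
    by rewrite ler_pM2r ?invr_gt0 // ler_nat.
  by rewrite ler_pM2r ?invr_gt0 // ler_nat.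
have sM : 0 < s M0 by apply: s_gt0; lia.
(* [D * s M0] covers the initial index. Since [m >= 8], [s m.+1 / s m <= 9/8], so the induction
   needs [3/4 L + K3 <= L], which [L >= 6 K3] ensures. *)
pose L := D * s M0 + 6 * K3.
have L0 : 0 <= L by rewrite addr_ge0 // mulr_ge0 // ltW.
exists L => // m beta Mm; rewrite -/(X m beta).
elim: m Mm => [|m IHm] Mm; first by lia.
have [E|Mm'] : m.+1 = M0 \/ (M0 <= m)%N by lia.
  rewrite E; apply: le_trans (HD beta) _; rewrite ler_pdivlMr // /L lerDl mulr_ge0 //.
have m0 : (0 < m)%N by lia.
have sm := s_gt0 m0; have sm1 : 0 < s m.+1 by exact: s_gt0.
apply: le_trans (rec m beta Mm') _.
apply: le_trans (_ : 2 / 3 * (L / s m) + K3 / s m.+1 <= _).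
  by rewrite lerD2r ler_wpM2l // IHm.
have /andP[r1 r2] := sqrt_ratioV m0.
rewrite -(ler_pM2r sm1) mulrDl !divfK ?gt_eqF //.
rewrite (_ : 2 / 3 * (L / s m) * s m.+1 = 2 / 3 * L * (s m.+1 / s m)); last by ring.
have m8 : m%:R^-1 <= 1 / 8 :> R.
  by rewrite div1r lef_pV2 ?posrE ?ltr0n // (ler_nat _ 8 m) (leq_trans M08).
apply: le_trans (_ : 2 / 3 * L * (9 / 8) + K3 <= _).
  by rewrite lerD2r ler_wpM2l ?mulr_ge0 //; lra.
have : 0 <= D * s M0 by rewrite mulr_ge0 // ltW.
by rewrite /L; lra.
Qed.

End CumulativeLimit.

(** * From uniform rates to convergence of suprema *)

Lemma ereal_sup_cvg0 (R : realType) (T : Type) (f : nat -> T -> R) (b0 : T) (K : R) M0 :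
  0 <= K -> (forall m b, (M0 <= m)%N -> `|f m b| <= K / Num.sqrt m%:R) ->
  ereal_sup [set (`|f m b|)%:E | b in [set: T]] @[m --> \oo] --> (0 : \bar R)%E.
Proof.
move=> K0 H.
apply: (@squeeze_cvge _ _ _ _ (fun=> 0%E) _ (fun m => (K / Num.sqrt m%:R)%:E)).
- near=> m; apply/andP; split.
    (* The point [b0] makes the supremum nonnegative; over an empty type it would be [-oo]. *)
    apply: le_ereal_sup_tmp; exists (`|f m b0|)%:E; first by exists b0.
    by rewrite lee_fin.
  apply: ge_ereal_sup => _ [b _ <-]; rewrite lee_fin; apply: H.
  by near: m; exact: nbhs_infty_ge.
- exact: cvg_cst.
- apply: cvg_EFin; first by near=> m.
  apply/cvgr0Pnorm_le => e e0; near=> m => /=.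
  have m0 : 0 < m%:R :> R by rewrite ltr0n; near: m; exact: nbhs_infty_gt.
  rewrite ger0_norm ?divr_ge0 ?sqrtr_ge0 // ler_pdivrMr ?sqrtr_gt0 // mulrC -ler_pdivrMr //.
  have Ke : 0 <= K / e by rewrite divr_ge0 // ltW.
  rewrite -[leLHS]ger0_norm // -sqrtr_sqr ler_wsqrtr //.
  by near: m; exact: nbhs_infty_ger.
Unshelve. all: by end_near. Qed.

Lemma powR_half_nat (R : realType) (a : R) (n : nat) : 0 <= a ->
  a `^ (n%:R / 2) = Num.sqrt a ^+ n.
Proof.
by move=> a0; rewrite mulrC powRrM powR12_sqrt // powR_mulrn // sqrtr_ge0.
Qed.

Theorem theorem3p7 (R : realType) (k : nat) (hk : (2 <= k)%N) :
  let q : R := 2 * k%:R - 1 in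
  let sigma2 : R := (k%:R - 1)^-1 in
  (ereal_sup
     [set (`| m%:R `^ (k%:R / 2) * ((n_count beta m)%:R / q ^+ m)
            - parity_factor R m beta / (2 * pi * sigma2) `^ (k%:R / 2)
              * expR (- (inner R beta / (2 * sigma2 * m%:R))) |)%:E
     | beta in [set: 'rV[int]_k]] @[m --> \oo] --> (0 : \bar R)%E)
  /\
  (ereal_sup
     [set (`| m%:R `^ (k%:R / 2) / 2
              * ((N_count beta m)%:R / (q ^+ m.+1 / (q - 1))
                 + (N_count beta m.+1)%:R / (q ^+ m.+2 / (q - 1)))
            - expR (- (inner R beta / (2 * sigma2 * m%:R)))
              / (2 * pi * sigma2) `^ (k%:R / 2) |)%:E
     | beta in [set: 'rV[int]_k]] @[m --> \oo] --> (0 : \bar R)%E).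
Proof.
move=> q sigma2.
have k1 := kap_ge1 R hk; have kp : 0 < k%:R - 1 :> R by lra.
have S0 : 0 <= 2 * pi * sigma2 by rewrite !mulr_ge0 ?pi_ge0 // invr_ge0 ltW.
have gE m (beta : 'rV[int]_k) : expR (- (inner R beta / (2 * sigma2 * m%:R)))
    / (2 * pi * sigma2) `^ (k%:R / 2) = gauss R m beta.
  rewrite gaussE powR_half_nat // mulrC exprVn; congr (_ * expR (- _)).
  by rewrite /sigma2 !invfM invrK; ring.
split.
  have [K K0 HK] := cyc_count_local_limit R hk.
  apply: (@ereal_sup_cvg0 _ _ _ 0 K k) => // m beta km.
  rewrite powR_half_nat // n_countE -mulrA [_^-1 * _]mulrC gE.
  exact: HK.
have [K K0 HK] := cumulative_local_limit R hk.
apply: (@ereal_sup_cvg0 _ _ _ 0 K (k * 2 ^ k)) => // m beta km.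
by rewrite powR_half_nat // gE; exact: HK.
Qed.
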